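(* Let $\omega$ be a non-quasianalytic weight function. Then the inclusions $$(\mathcal{O}_{M,\omega}(\mathbb{R}^N),\tau)\hookrightarrow (\mathcal{O}_{M,\omega}(\mathbb{R}^N),\tau_b)\hookrightarrow (\mathcal{O}_{M,\omega}(\mathbb{R}^N),\tau_s)$$ are continuous. Moreover, the spaces $(\mathcal{O}_{M,\omega}(\mathbb{R}^N),\tau)$, $(\mathcal{O}_{M,\omega}(\mathbb{R}^N),\tau_b)$ and $(\mathcal{O}_{M,\omega}(\mathbb{R}^N),\tau_s)$ have the same bounded subsets.
   Context: A non-quasianalytic weight function is a continuous increasing function $\omega:[0,\infty)\to[0,\infty)$ such that: $(\alpha)$ there is $K\geq 1$ with $\omega(2t)\leq K(1+\omega(t))$ for all $t\geq 0$; $(\beta)$ $\int_1^\infty \frac{\omega(t)}{1+t^2}\,dt<\infty$; $(\gamma)$ there are $a\in\mathbb{R}$, $b>0$ with $\omega(t)\geq a+b\log(1+t)$ for all $t\geq 0$; $(\delta)$ $\varphi_\omega(t)=\omega(e^t)$ is convex. Standing normalization: $\omega$ vanishes on $[0,1]$. For $x\in\mathbb{R}^N$ put $\omega(x):=\omega(|x|)$ with $|\cdot|$ the Euclidean norm. The Young conjugate is $\varphi^*_\omega(s):=\sup_{t\geq 0}\{st-\varphi_\omega(t)\}\ge 0$, $s\geq 0$; the value $+\infty$ is allowed, with $\exp(-\infty)=0$ and $\exp(+\infty)=+\infty$. Functions are complex-valued, $\mathbb{N}=\{1,2,\dots\}$, $\mathbb{N}_0=\mathbb{N}\cup\{0\}$.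 $\mathcal{S}_\omega(\mathbb{R}^N)$ is the set of $f\in L^1(\mathbb{R}^N)$ with $f,\hat f\in C^\infty(\mathbb{R}^N)$ and $\|\exp(\lambda\omega)\partial^\alpha f\|_\infty<\infty$, $\|\exp(\lambda\omega)\partial^\alpha \hat f\|_\infty<\infty$ for all $\lambda>0$, $\alpha\in\mathbb{N}_0^N$. Equivalently (known), it is the set of $f\in C^\infty(\mathbb{R}^N)$ with $q_{\lambda,\mu}(f):=\sup_{\alpha}\sup_{x}\exp\left(-\lambda\varphi^*_\omega(|\alpha|/\lambda)\right)\exp(\mu\omega(x))|\partial^\alpha f(x)|<\infty$ for all $\lambda,\mu>0$. Its Fréchet topology is generated by the norms $q_{m,n}$, $m,n\in\mathbb{N}$. $\mathcal{O}_{M,\omega}(\mathbb{R}^N)$ is the set of all $f\in C^\infty(\mathbb{R}^N)$ such that for each $m\in\mathbb{N}$ there exist $C>0$ and $n\in\mathbb{N}$ with $|\partial^\alpha f(x)|\leq C\exp\left(n\omega(x)+m\varphi^*_\omega(|\alpha|/m)\right)$ for all $\alpha\in\mathbb{N}_0^N$, $x\in\mathbb{R}^N$. For $f\in\mathcal{O}_{M,\omega}(\mathbb{R}^N)$ the multiplication operator $M_f(g)=fg$ is a continuous linear operator on $\mathcal{S}_\omega(\mathbb{R}^N)$, and $f\mapsto M_f$ identifies $\mathcal{O}_{M,\omega}(\mathbb{R}^N)$ with a subspace of the space $\mathcal{L}(\mathcal{S}_\omega(\mathbb{R}^N))$ of continuous linear operators on $\mathcal{S}_\omega(\mathbb{R}^N)$.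 Topologies on $\mathcal{O}_{M,\omega}(\mathbb{R}^N)$: $\tau$ is generated by the seminorms $q_{m,g}(f):=\sup_{\alpha\in\mathbb{N}_0^N}\sup_{x\in\mathbb{R}^N}|g(x)||\partial^\alpha f(x)|\exp\left(-m\varphi^*_\omega(|\alpha|/m)\right)$, $m\in\mathbb{N}$, $g\in\mathcal{S}_\omega(\mathbb{R}^N)$ (finite on $\mathcal{O}_{M,\omega}(\mathbb{R}^N)$); $\tau_b$ is the topology induced, via $f\mapsto M_f$, by the topology of uniform convergence on bounded subsets of $\mathcal{S}_\omega(\mathbb{R}^N)$ on $\mathcal{L}(\mathcal{S}_\omega(\mathbb{R}^N))$, i.e. generated by the seminorms $f\mapsto\sup_{g\in B}q_{m,n}(fg)$ with $B\subset\mathcal{S}_\omega(\mathbb{R}^N)$ bounded, $m,n\in\mathbb{N}$; $\tau_s$ is the one induced by the strong operator topology, i.e. generated by the seminorms $f\mapsto q_{m,n}(fg)$, $g\in\mathcal{S}_\omega(\mathbb{R}^N)$, $m,n\in\mathbb{N}$. *)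

(* Defs.v *)
From HB Require Import structures.
From mathcomp Require Import all_boot all_order all_algebra.
From mathcomp Require Import complex.
From mathcomp Require Import all_classical all_reals all_analysis.
Set Implicit Arguments.
Unset Strict Implicit.
Unset Printing Implicit Defensive.
Import Order.TTheory GRing.Theory Num.Theory.
Import numFieldNormedType.Exports.
Local Open Scope classical_set_scope.
Local Open Scope ring_scope.
Local Open Scope complex_scope.

(* [lcspace X P] is the set X (meant to be a linear subspace of V) with the
   locally convex topology generated by the family P of functionals (meant to
   be seminorms that are finite on X). *)
Section SeminormTopology.
Variables (K : numDomainType) (V : lmodType K) (R : realType).

Definition lcspace (X : set V) (P : set (V -> \bar R)) : Type := X.

Variables (X : set V) (P : set (V -> \bar R)).

HB.instance Definition _ := Choice.on (lcspace X P).

Definition seminorm_ball (p : V -> \bar R) (f0 : lcspace X P) (e : R) :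
    set (lcspace X P) :=
  [set f | (p (\val f - \val f0)%R < e%:E)%E].

HB.instance Definition _ := @isSubBaseTopological.Build (lcspace X P)
  (set (lcspace X P))
  [set U | exists p f0 e, [/\ P p, 0 < e & U = seminorm_ball p f0 e]] id.

(* Von Neumann boundedness: every neighbourhood of the origin absorbs B. *)
Definition lc_bounded (B : set (lcspace X P)) : Prop :=
  forall z : lcspace X P, \val z = 0 ->
  forall U : set (lcspace X P), nbhs z U ->
  exists2 r : K, 0 < r &
    forall f, B f -> exists2 u, U u & \val f = r *: \val u.

End SeminormTopology.

Arguments lc_bounded {K V R} X P B.

Section Weight.
Variable R : realType.
Implicit Types omega : R -> R.

(* Only the values of omega on [0, +oo[ matter. *)
Record nonquasianalytic_weight omega : Prop := NonquasianalyticWeight {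
  weight_continuous : {within `[0, +oo[, continuous omega} ;
  weight_increasing :
    {in `[0, +oo[ &, {homo omega : s t / s <= t}} ;
  weight_ge0 : forall t : R, 0 <= t -> 0 <= omega t ;
  weight_alpha : exists2 K : R, 1 <= K &
    forall t : R, 0 <= t -> omega (2 * t) <= K * (1 + omega t) ;
  weight_beta : (\int[lebesgue_measure]_(t in `[1%R, +oo[)
    (omega t / (1 + t ^+ 2))%:E < +oo)%E ;
  weight_gamma : exists a b : R, 0 < b /\
    forall t : R, 0 <= t -> a + b * ln (1 + t) <= omega t ;
  weight_delta :
    convex_function [set: R^o] (fun t : R^o => omega (expR t) : R^o) ;
  weight_normalized : forall t : R, 0 <= t <= 1 -> omega t = 0 }.

Definition young_conj omega (s : R) : \bar R :=
  ereal_sup [set (s * t - omega (expR t))%:E | t in `[0, +oo[].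

End Weight.

Section Spaces.
Variables (R : realType) (N : nat).

Definition Efun := 'rV[R]_N -> R[i]^o.

HB.instance Definition _ := GRing.Lmodule.on Efun.

(* The norm of the library on 'rV[R]_N is the sup norm. *)
Definition euclid_norm (x : 'rV[R]_N) : R :=
  Num.sqrt (\sum_(j < N) x 0 j ^+ 2).

Definition modulus (z : R[i]) : R := ComplexField.Normc.normc z.

(* R[i] is not a normed module over R, so the real and imaginary parts are
   differentiated separately. *)
Definition partial (j : 'I_N) (f : Efun) : Efun := fun x =>
  'D_(delta_mx 0 j) (fun y => complex.Re (f y)) x
    +i* 'D_(delta_mx 0 j) (fun y => complex.Im (f y)) x.

Definition partials (s : seq 'I_N) (f : Efun) : Efun := foldr partial f s.

(* C^oo: iterated partial derivatives of all orders, taken in any order of the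
   variables, exist and are continuous. *)
Definition smooth (f : Efun) : Prop :=
  forall (s : seq 'I_N) (g := partials s f),
    [/\ continuous (fun y => complex.Re (g y)),
        continuous (fun y => complex.Im (g y)) &
     forall x j, derivable (fun y => complex.Re (g y)) x (delta_mx 0 j) /\
                 derivable (fun y => complex.Im (g y)) x (delta_mx 0 j)].

Definition multiindex := 'I_N -> nat.

Definition mlength (a : multiindex) : nat := (\sum_(j < N) a j)%N.

Definition mderiv (a : multiindex) (f : Efun) : Efun :=
  foldr (fun j g => iter (a j) (partial j) g) f (enum 'I_N).

Variable omega : R -> R.

Definition scaled_conj (l : R) (a : multiindex) : \bar R :=
  (l%:E * young_conj omega ((mlength a)%:R / l))%E.

(* If the conjugate is +oo the weight is 0, whatever the value of the
   derivative. *)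
Definition qnorm (l m : R) (f : Efun) : \bar R :=
  ereal_sup [set (expeR (- scaled_conj l ax.1) *
    (expR (m * omega (euclid_norm ax.2)) * modulus (mderiv ax.1 f ax.2))%:E)%E
    | ax in [set: multiindex * 'rV[R]_N]].

(* The Beurling-Bjorck space S_omega, described by the norms which also define
   its Frechet topology. *)
Definition Sset : set Efun := [set f | smooth f /\
  forall l m : R, 0 < l -> 0 < m -> (qnorm l m f < +oo)%E].

Definition pos_nat : set nat := [set n | (0 < n)%N].

Definition S_seminorms : set (Efun -> \bar R) :=
  [set qnorm m%:R n%:R | m in pos_nat & n in pos_nat].

Definition Sspace := lcspace Sset S_seminorms.

Definition OM : set Efun := [set f | smooth f /\
  forall m : nat, pos_nat m -> exists C : R, exists n : nat,
    [/\ 0 < C, pos_nat n & forall (a : multiindex) (x : 'rV[R]_N),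
     ((modulus (mderiv a f x))%:E <= C%:E *
       expeR ((n%:R * omega (euclid_norm x))%:E + scaled_conj m%:R a))%E]].

Definition mulE (f g : Efun) : Efun := fun x => (f x : R[i]) * g x.

Definition tau_seminorm (m : nat) (g : Sspace) (f : Efun) : \bar R :=
  ereal_sup [set ((modulus (\val g ax.2) * modulus (mderiv ax.1 f ax.2))%:E *
    expeR (- scaled_conj m%:R ax.1))%E
    | ax in [set: multiindex * 'rV[R]_N]].

Definition tau_seminorms : set (Efun -> \bar R) :=
  [set tau_seminorm m g | m in pos_nat & g in [set: Sspace]].

(* For B empty the value is -oo, and the corresponding balls are the whole
   space. *)
Definition taub_seminorm (m n : nat) (B : set Sspace) (f : Efun) : \bar R :=
  ereal_sup [set qnorm m%:R n%:R (mulE f (\val g)) | g in B].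

Definition taub_seminorms : set (Efun -> \bar R) :=
  [set p | exists m n B, [/\ pos_nat m, pos_nat n,
     lc_bounded Sset S_seminorms B &
     p = taub_seminorm m n B]].

Definition taus_seminorm (m n : nat) (g : Sspace) (f : Efun) : \bar R :=
  qnorm m%:R n%:R (mulE f (\val g)).

Definition taus_seminorms : set (Efun -> \bar R) :=
  [set p | exists m n g, [/\ pos_nat m, pos_nat n & p = taus_seminorm m n g]].

End Spaces.

Arguments OM {R} N omega.
Arguments tau_seminorms {R} N omega.
Arguments taub_seminorms {R} N omega.
Arguments taus_seminorms {R} N omega.

Section OMTopologies.
Variables (R : realType) (N : nat) (omega : R -> R).

Definition OM_tau := lcspace (OM N omega) (tau_seminorms N omega).
Definition OM_taub := lcspace (OM N omega) (taub_seminorms N omega).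
Definition OM_taus := lcspace (OM N omega) (taus_seminorms N omega).

End OMTopologies.

Arguments OM_tau {R} N omega.
Arguments OM_taub {R} N omega.
Arguments OM_taus {R} N omega.

(* Main.v *)
From HB Require Import structures.
Require Import Defs.
From mathcomp Require Import all_boot all_order all_algebra complex.
From mathcomp Require Import all_classical all_reals all_analysis.
From mathcomp Require Import finmap measurable_realfun.
From mathcomp Require Import ring lra.
Set Implicit Arguments.
Unset Strict Implicit.
Unset Printing Implicit Defensive.
Import Order.TTheory GRing.Theory Num.Theory.
Import numFieldNormedType.Exports.
Local Open Scope classical_set_scope.
Local Open Scope ring_scope.

(* The three topologies coincide. Let [h] in [S_omega] be a product of
   superpositions of translates of [1 / cosh]. It can dominate any prescribed
   rapidly decreasing function, while the derivatives of both [h] and [1 / h]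
   obey bounds of real analytic type relative to [h] and [1 / h]. As
   [omega t = o(t)] by (beta), such bounds are stronger than those defining
   [S_omega]. If [h] dominates a bounded set B with its weighted derivatives,
   Leibniz' rule bounds the tau_b seminorms over B by a single tau seminorm
   given by [h]. Conversely, expanding the derivatives of [f = (f h) (1 / h)]
   bounds the tau seminorm given by [h] by one seminorm of [f h], that is, by a
   tau_s seminorm, and no Banach-Steinhaus argument is needed. *)

(** * Weight functions *)

(** A tau seminorm multiplies the derivatives of [f] by [g], whereas a tau_s seminorm differentiates
    [f g]. Recovering the former from the latter means dividing by the multiplier, so the
    derivatives of its reciprocal must be controlled relative to the reciprocal itself. Compactly
    supported functions have no reciprocal, and the derivatives of a Gaussian are unbounded relative
    to it. The bound [|u^(n)| <= A^n n! u] holds for [cosh] with [A = 1], passes with the same [A]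
    to translates and nonnegative superpositions, and passes to reciprocals with [2 A]. Hence the
    order of the construction (invert [cosh], superpose, invert again) and the constants 1, 2, 4.
    The conjugate may be infinite, so its exponential weight can vanish; it is handled as an infimum
    over radii [r >= 1]. Leibniz' rule costs a factor [2^|a|] and a splitting of [|a|] into two
    orders; both are paid for by enlarging the parameter of the conjugate. *)

Section Weight.
Variables (R : realType) (omega : R -> R).
Hypothesis homega : nonquasianalytic_weight omega.

Lemma weight_mono (s t : R) : 0 <= s -> s <= t -> omega s <= omega t.
Proof.
move=> s0 st; apply: (weight_increasing homega) => //;
  by rewrite in_itv /= andbT ?(le_trans s0).
Qed.

Lemma weight_dilate (A : R) : 0 <= A -> exists2 K : R, 1 <= K &
  forall t : R, 0 <= t -> omega (A * t) <= K * (1 + omega t).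
Proof.
have [K K1 hK] := weight_alpha homega.
have pow2 n : exists2 K' : R, 1 <= K' &
    forall t : R, 0 <= t -> omega (2 ^+ n * t) <= K' * (1 + omega t).
  elim: n => [|n [K' K'1 IH]].
    by exists 1 => // t t0; rewrite expr0 !mul1r lerDr.
  exists (K * (1 + K')) => [|t t0]; first by nra.
  have p0 : 0 <= 2 ^+ n * t by rewrite mulr_ge0// exprn_ge0.
  rewrite exprS -mulrA; apply: (le_trans (hK _ p0)).
  rewrite -mulrA ler_pM2l; last exact: lt_le_trans K1.
  by have := IH t t0; have := weight_ge0 homega t0; nra.
move=> A0.
have [n hn] : exists n, A <= 2 ^+ n.
  exists (Num.Def.truncn A).+1.
  apply/ltW/(lt_le_trans (truncnS_gt _)).
  by rewrite -natrX ler_nat ltnW// ltn_expl.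
have [K' K'1 hK'] := pow2 n; exists K' => // t t0.
by apply: le_trans (hK' t t0); apply: weight_mono; nra.
Qed.

Lemma weight_quotient_measurable (D : set R) : measurable D ->
  D `<=` `[0, +oo[ -> measurable_fun D (fun t => omega t / (1 + t ^+ 2)).
Proof.
move=> mD D0.
suff m0 : measurable_fun (`[0, +oo[%classic : set R)
    (fun t => omega t / (1 + t ^+ 2)).
  exact: (measurable_funS _ D0 m0).
apply: measurable_funM.
  apply: subspace_continuous_measurable_fun => //.
  exact: weight_continuous.
apply: measurable_funTS; apply: continuous_measurable_fun => t.
have c1 : {for t, continuous (fun x : R => 1 + x ^+ 2)}.
  by apply: cvgD; [exact: cvg_cst|exact: exprn_continuous].
by apply: cvgV => //; rewrite gt_eqF// ltr_pwDl// sqr_ge0.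
Qed.

(** On [[2^i, 2^(i+1)[] one has [1 + t^2 <= 5 * 4^i] and [omega t >= omega (2^i)], and the interval
    has length [2^i]. *)
Lemma weight_dyadic_series (n : nat) :
  ((\sum_(i < n) omega (2 ^+ i) / (5 * 2 ^+ i))%:E <=
   \int[lebesgue_measure]_(t in `[1%R, (2 ^+ n)%R[)
      (omega t / (1 + t ^+ 2))%:E)%E.
Proof.
pose f (t : R) := omega t / (1 + t ^+ 2).
have f0 t : 0 <= t -> 0 <= f t.
  by move=> t0; rewrite divr_ge0 ?(weight_ge0 homega)// addr_ge0 ?sqr_ge0.
have mf := weight_quotient_measurable.
have sub0 (a : R) (b : itv_bound R) : 1 <= a ->
    [set` Interval (BLeft a) b] `<=` `[0, +oo[%classic.
  move=> a1 x /=; rewrite !in_itv /= => /andP[ax _].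
  by rewrite andbT (le_trans _ ax)// (le_trans _ a1).
elim: n => [|n IH].
  by rewrite big_ord0 expr0 set_itvco0 integral_set0.
have p1 : 1 <= 2 ^+ n :> R by rewrite exprn_ege1// ler1n.
have pS : 2 ^+ n <= 2 ^+ n.+1 :> R by rewrite exprS ler_peMl// ?ler1n// exprn_ge0.
have -> : `[1%R, (2 ^+ n.+1)%R[%classic =
    `[1%R, (2 ^+ n)%R[ `|` `[(2 ^+ n)%R, (2 ^+ n.+1)%R[ :> set R.
  by rewrite -itv_bndbnd_setU ?bnd_simp.
rewrite ge0_integral_setU //=; last 3 first.
- apply/measurable_EFinP; apply: mf; first by apply: measurableU.
  by rewrite subUset; split; apply: sub0; rewrite ?lexx.
- move=> x; rewrite lee_fin => hx; apply: f0.
  by case: hx; rewrite /= in_itv/= => /andP[hx _]; lra.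
- apply/disj_setPLR => x /=; rewrite !in_itv /= => /andP[_ xn] /andP[nx _].
  by have := lt_le_trans xn nx; rewrite ltxx.
rewrite big_ord_recr EFinD; apply: leeD => //.
apply: (@le_trans _ _
  (\int[lebesgue_measure]_(t in `[(2 ^+ n)%R, (2 ^+ n.+1)%R[)
    (omega (2 ^+ n) / (5 * 2 ^+ n * 2 ^+ n))%:E)%E).
  rewrite integral_cst//= lebesgue_measure_itv/= lte_fin exprS.
  rewrite ltr_pMl ?exprn_gt0// ltr1n/= -EFinD -EFinM lee_fin.
  have n0 : 2 ^+ n != 0 :> R by rewrite expf_neq0.
  by rewrite le_eqVlt; apply/orP; left; apply/eqP; field.
apply: ge0_le_integral => //=.
- by move=> x _; rewrite lee_fin divr_ge0 ?(weight_ge0 homega)//; nra.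
- by apply/measurable_EFinP; apply: mf => //; apply: sub0.
move=> x; rewrite in_itv/= => /andP[nx xn]; rewrite lee_fin.
rewrite exprS in xn.
apply: ler_pM.
- by rewrite (weight_ge0 homega)// ltW// exprn_gt0.
- by rewrite invr_ge0; nra.
- by apply: weight_mono => //; rewrite exprn_ge0.
- by rewrite lef_pV2 ?posrE; nra.
Qed.

(* [weight_beta] forces [omega t = o(t)], which makes every bound of real
   analytic type stronger than those of [S_omega]. *)
Lemma weight_sublinear (e : R) : 0 < e ->
  exists2 C : R, 0 <= C & forall t : R, 0 <= t -> omega t <= e * t + C.
Proof.
move=> e0.
pose a (i : nat) : R := omega (2 ^+ i) / (5 * 2 ^+ i).
have p0 i : 0 < 2 ^+ i :> R by rewrite exprn_gt0.
have a0 i : 0 <= a i.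
  by rewrite /a divr_ge0 ?(weight_ge0 homega)// ?mulr_ge0// ltW.
set I := (\int[lebesgue_measure]_(t in `[1%R, +oo[)
   (omega t / (1 + t ^+ 2))%:E)%E.
(* The terms of a convergent series tend to 0. The threshold [e / 10] is chosen so that for
   [2^n <= t < 2^(n+1)] one gets [omega t <= omega (2^(n+1)) <= (e / 10) * 5 * 2^(n+1) = e * 2^n <=
   e * t]. *)
have [n0 hn0] : exists n0 : nat, forall n, (n0 <= n)%N -> a n < e / 10.
  have cs : cvgn (series a).
    apply: nondecreasing_is_cvgn.
      apply/nondecreasing_seqP => n.
      by rewrite !seriesEnat /= big_nat_recr//= lerDl.
    exists (fine I) => _ [n _ <-].
    have If : (I < +oo)%E := weight_beta homega.
    have sI : ((series a n)%:E <= I)%E.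
      rewrite seriesEnat /= big_mkord; apply: (le_trans (weight_dyadic_series n)).
      apply: ge0_subset_integral => //=.
      - apply/measurable_EFinP; apply: weight_quotient_measurable => //.
        by move=> x /=; rewrite !in_itv/= !andbT; exact: le_trans.
      - move=> x; rewrite in_itv/= andbT => x1; rewrite lee_fin.
        rewrite divr_ge0 ?addr_ge0 ?sqr_ge0// (weight_ge0 homega)//.
        exact: le_trans x1.
      - by move=> x /=; rewrite !in_itv/= => /andP[->].
    have s0 : 0 <= series a n by rewrite seriesEnat/= sumr_ge0.
    rewrite -lee_fin fineK// ge0_fin_numE//.
    by apply: le_trans sI; rewrite lee_fin.
  have := cvg_series_cvg_0 cs => /cvgrPdist_lt /(_ (e / 10)).
  have e10 : 0 < e / 10 by lra.
  move=> /(_ e10)[n0 _ h]; exists n0 => n nn; have := h n nn.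
  by rewrite sub0r normrN ger0_norm.
exists (omega (2 ^+ n0)); first by rewrite (weight_ge0 homega)// ltW.
move=> t t0.
have [tn|nt] := leP t (2 ^+ n0).
  by have := weight_mono t0 tn; nra.
have ex : exists n, t < 2 ^+ n.
  exists (Num.Def.truncn t).+1; apply: (lt_le_trans (truncnS_gt _)).
  by rewrite -natrX ler_nat ltnW// ltn_expl.
case: (ex_minnP ex) => -[|n] tn mn.
  have : 1 <= 2 ^+ n0 :> R by rewrite exprn_ege1// ler1n.
  by move: tn; rewrite expr0 => t1 n1; exfalso; move: (lt_trans nt t1); lra.
have nt' : 2 ^+ n <= t by rewrite leNgt; apply/negP => /mn; rewrite ltnn.
have nn0 : (n0 <= n.+1)%N.
  rewrite leqNgt; apply/negP => nS; have := lt_trans nt tn.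
  by rewrite ltr_eXn2l// ?ltr1n// => /(ltn_trans nS); rewrite ltnn.
have := hn0 _ nn0; rewrite /a ltr_pdivrMr ?mulr_gt0// => h.
have := weight_mono t0 (ltW tn).
have := weight_ge0 homega (ltW (p0 n0)).
by move: h; rewrite exprS; have := p0 n; nra.
Qed.

End Weight.

(** * The conjugate weights *)

Section ConjugateWeight.
Variables (R : realType) (omega : R -> R).

(* [exp (- l phi^* (k / l))], that is, the infimum over [r >= 1] of
   [exp (l omega r) / r ^ k]; it is [0] if the conjugate is infinite. *)
Definition conj_weight (l : R) (k : nat) : R :=
  fine (expeR (- (l%:E * young_conj omega (k%:R / l)))%E).

Lemma conj_weight_ge0 l k : 0 <= conj_weight l k.
Proof. by rewrite /conj_weight fine_ge0// expeR_ge0. Qed.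

Hypothesis homega : nonquasianalytic_weight omega.

Lemma young_conj_ge0 s : (0 <= young_conj omega s)%E.
Proof.
apply: ereal_sup_ubound; exists 0; first by rewrite /= in_itv/= lexx.
by rewrite expR0 (weight_normalized homega) ?lexx ?ler01// mulr0 subrr.
Qed.

(** The conjugate is nonnegative, hence never [-oo], so this exponential is finite and all later
    estimates can be made with real numbers. *)
Lemma expeR_scaled_conj N l (a : multiindex N) : 0 < l ->
  expeR (- scaled_conj omega l a) = (conj_weight l (mlength a))%:E.
Proof.
move=> l0; rewrite /scaled_conj /conj_weight.
have := young_conj_ge0 ((mlength a)%:R / l).
case: (young_conj _ _) => [y|_|]//; rewrite ?leeNy_eq//.
by rewrite gt0_muley ?lte_fin.
Qed.

Lemma conj_weight_le l k r : 0 < l -> 1 <= r ->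
  conj_weight l k * r ^+ k <= expR (l * omega r).
Proof.
move=> l0 r1; have r0 : 0 < r by exact: lt_le_trans r1.
have : ((k%:R / l * ln r - omega r)%:E <= young_conj omega (k%:R / l))%E.
  apply: ereal_sup_ubound; exists (ln r); rewrite ?lnK ?posrE//.
  by rewrite /= in_itv/= andbT ln_ge0.
rewrite /conj_weight; case: (young_conj _ _) => [y| |]//.
  rewrite lee_fin /= => hy; rewrite -[r in r ^+ k]lnK ?posrE// -expRM_natl.
  rewrite -expRD ler_expR.
  have : l * (k%:R / l * ln r - omega r) <= l * y by rewrite ler_pM2l.
  rewrite mulrBr !mulrA [l * k%:R / l]mulrAC divff ?gt_eqF// mul1r.
  lra.
by move=> _; rewrite gt0_muley ?lte_fin//= mul0r expR_ge0.
Qed.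

(** For [c > 0] and [r = exp t], the hypothesis reads [t k / l - omega (exp t) <= - ln c / l], a
    bound on the conjugate. Together with [conj_weight_le] this is the characterization as an
    infimum through which the weight is used from here on. *)
Lemma conj_weight_ge l k c : 0 < l ->
  (forall r, 1 <= r -> c * r ^+ k <= expR (l * omega r)) ->
  c <= conj_weight l k.
Proof.
move=> l0 h; have [c0|c0] := leP c 0.
  exact: le_trans (conj_weight_ge0 _ _).
have hy : (young_conj omega (k%:R / l) <= (- ln c / l)%:E)%E.
  apply: ge_ereal_sup => _ [t t0 <-]; rewrite lee_fin.
  move: t0; rewrite /= in_itv/= andbT => t0.
  have e1 : 1 <= expR t by rewrite -expR0 ler_expR.
  have := h _ e1.
  rewrite -[c in c * _]lnK ?posrE// -expRM_natl -expRD ler_expR => h'.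
  rewrite ler_pdivlMr// mulrBl mulrAC divfK ?gt_eqF//; lra.
have := young_conj_ge0 (k%:R / l); move: hy; rewrite /conj_weight.
case: (young_conj _ _) => [y| |]//; rewrite lee_fin /= => hy _.
rewrite -[c in c <= _]lnK ?posrE// ler_expR.
by move: hy; rewrite ler_pdivlMr// mulrC; lra.
Qed.

(* The conjugates are superadditive up to a change of parameter, because
   [omega (max r s) <= omega r + omega s]; the change of parameter also absorbs
   geometric factors. *)
Lemma conj_weight_mul (l A : R) : 0 < l -> 1 <= A ->
  exists l' : nat, exists C : R, [/\ (0 < l')%N, 0 < C & forall i j,
    A ^+ (i + j) * conj_weight l (i + j) <=
      C * (conj_weight l'%:R i * conj_weight l'%:R j)].
Proof.
move=> l0 A1; have A0 : 0 <= A by lra.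
have [K K1 hK] := weight_dilate homega A0.
pose l' := (Num.Def.truncn (K * l)).+1.
have Kl : K * l <= l'%:R by apply/ltW/truncnS_gt.
have l'0 : 0 < l'%:R :> R by rewrite ltr0n.
exists l', (expR (l * K)); split=> // [|i j]; first exact: expR_gt0.
set c := A ^+ _ * _.
have c0 : 0 <= c by rewrite mulr_ge0 ?exprn_ge0 ?conj_weight_ge0.
(* Replace [r] and [s] by [M = max r s] and test the infimum at the radius [A * M]: the geometric
   factor is absorbed, and [omega (A * M) <= K * (1 + omega M)]. The infima over [r] and then over
   [s] are taken separately afterwards. *)
have hc r s : 1 <= r -> 1 <= s -> c / expR (l * K) * r ^+ i * s ^+ j <=
    expR (l'%:R * omega r) * expR (l'%:R * omega s).
  move=> r1 s1; set M := Num.max r s.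
  have [rM sM] : r <= M /\ s <= M by rewrite /M !le_max !lexx orbT.
  have M1 : 1 <= M by exact: le_trans rM.
  have AM1 : 1 <= A * M by rewrite mulr_ege1.
  have M0 : 0 <= M by lra.
  have ws := weight_ge0 homega (le_trans ler01 s1).
  have wr := weight_ge0 homega (le_trans ler01 r1).
  have wM : omega M <= omega r + omega s.
    by rewrite /M; have [_|_] := leP r s; lra.
  have w0 := weight_ge0 homega M0.
  rewrite -[leLHS](_ : c * (r ^+ i * s ^+ j) / expR (l * K) = _); last by ring.
  rewrite ler_pdivrMr ?expR_gt0// -!expRD.
  apply: (@le_trans _ _ (c * M ^+ (i + j))).
    rewrite ler_wpM2l// exprD ler_pM ?exprn_ge0//; try lra.
    - by rewrite lerXn2r// nnegrE; lra.
    - by rewrite lerXn2r// nnegrE; lra.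
  rewrite /c mulrAC -exprMn mulrC.
  apply: (le_trans (conj_weight_le _ l0 AM1)); rewrite ler_expR.
  have : l * omega (A * M) <= l * (K * (1 + omega M)).
    by rewrite ler_pM2l ?hK.
  have : K * l * omega M <= l'%:R * (omega r + omega s).
    by rewrite ler_pM// mulr_ge0//; lra.
  by rewrite !mulrDr; lra.
rewrite mulrC -ler_pdivrMr ?expR_gt0//.
have h1 s : 1 <= s ->
    c / expR (l * K) * s ^+ j / expR (l'%:R * omega s) <= conj_weight l'%:R i.
  move=> s1; apply: conj_weight_ge => // r r1.
  rewrite mulrAC ler_pdivrMr ?expR_gt0// mulrAC.
  exact: hc.
have d0 : 0 <= c / expR (l * K) by rewrite divr_ge0// expR_ge0.
(* Taking the infimum over [s] requires dividing by this weight, which vanishes when the conjugate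
   is infinite; in that case [s = 1] already shows the left side to be at most 0. *)
have [vi|vi] := eqVneq (conj_weight l'%:R i) 0.
  have := h1 1 (lexx _); rewrite vi expr1n mulr1 mul0r.
  by rewrite (weight_normalized homega) ?lexx ?ler01// mulr0 expR0 divr1.
have vi0 : 0 < conj_weight l'%:R i by rewrite lt_neqAle eq_sym vi conj_weight_ge0.
rewrite [leRHS]mulrC -ler_pdivrMr//; apply: conj_weight_ge => // s s1.
by have := h1 s s1; rewrite ler_pdivrMr ?expR_gt0// => h2;
   rewrite mulrAC ler_pdivrMr// [leRHS]mulrC.
Qed.

Lemma fact_le_expn n : (n`! <= n ^ n)%N.
Proof.
elim: n => // n IH; rewrite factS expnS leq_mul2l /=.
by apply: (leq_trans IH); case: n {IH} => // n; rewrite leq_exp2r.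
Qed.

(** Test the infimum at [r = 2 A k]. With [e = 1 / (4 l A)] in [weight_sublinear], [exp (l omega r)]
    is at most [exp (k / 2) <= 2^k] up to a constant, while [r^k = 2^k A^k k^k >= 2^k A^k k!]. The
    case [k = 0] is apart because then [r < 1]. *)
Lemma conj_weight_fact (l A : R) : 0 < l -> 0 < A -> exists2 C : R, 0 < C &
  forall k, A ^+ k * k`!%:R * conj_weight l k <= C.
Proof.
move=> l0 A0'; wlog A1 : A A0' / 1 <= A.
  move=> /(_ (Num.max A 1)); rewrite lt_max A0' le_max lexx orbT.
  case=> // C C0 hC; exists C => // k; apply: le_trans (hC k).
  rewrite !ler_wpM2r ?conj_weight_ge0 ?ler0n//.
  by rewrite lerXn2r ?nnegrE ?le_max ?lexx ?ler01 ?orbT// ltW.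
have A0 : 0 <= A := ltW A0'.
pose e := (4 * l * A)^-1.
have e0 : 0 < e by rewrite invr_gt0; nra.
have [C0 C00 hC0] := weight_sublinear homega e0.
exists (expR (l * C0) + conj_weight l 0).
  by rewrite ltr_pwDl ?expR_gt0 ?conj_weight_ge0.
case=> [|k].
  by rewrite fact0 expr0 !mul1r lerDr expR_ge0.
set n := k.+1; have n0 : 0 < n%:R :> R by rewrite ltr0n.
apply: (@le_trans _ _ (expR (l * C0))); last first.
  by rewrite lerDl conj_weight_ge0.
have n1 : 1 <= n%:R :> R by rewrite ler1n.
have r1 : 1 <= 2 * A * n%:R by nra.
have r0 : 0 <= 2 * A * n%:R by nra.
have h1 := hC0 _ r0; rewrite -(ler_pM2l l0) -ler_expR in h1.
have := le_trans (conj_weight_le n l0 r1) h1.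
have -> : l * (e * (2 * A * n%:R) + C0) = n%:R * (2^-1) + l * C0.
  by rewrite /e; field; rewrite !gt_eqF.
rewrite expRD expRM_natl => h3.
have e2 : expR (2^-1) <= 2 :> R.
  have := expR_ge1Dx (- 2^-1 : R); rewrite expRN => h.
  rewrite -[leRHS]invrK -[leLHS]invrK lef_pV2 ?posrE ?invr_gt0 ?expR_gt0//.
  lra.
have h4 : conj_weight l n * (2 * A * n%:R) ^+ n <= 2 ^+ n * expR (l * C0).
  apply: (le_trans h3); rewrite ler_wpM2r ?expR_ge0//.
  by rewrite lerXn2r// nnegrE ?expR_ge0.
have p2 : 0 < 2 ^+ n :> R by rewrite exprn_gt0.
rewrite -(ler_pM2l p2); apply: le_trans h4.
rewrite !exprMn [leRHS]mulrC !mulrA ler_wpM2r ?conj_weight_ge0//.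
rewrite ler_wpM2l ?mulr_ge0 ?exprn_ge0// -natrX ler_nat.
exact: fact_le_expn.
Qed.

End ConjugateWeight.

(** * Taylor coefficients of real analytic type *)

Section RealLemmas.
Variable R : realType.
Implicit Types (f df : R -> R) (c r : R ^nat).

Lemma MVT_dist f df (x y : R) : (forall t, is_derive (t : R) (1 : R) f (df t)) ->
  exists2 z, `|z - x| <= `|y - x| & f y - f x = df z * (y - x).
Proof.
move=> fd; have cf : continuous f.
  by move=> t; apply/differentiable_continuous/derivable1_diffP/ex_derive.
have [xy|/ltW yx] := leP x y.
  have [|z] := MVT_segment xy (fun t _ => fd t).
    exact: continuous_subspaceT.
  rewrite in_itv/= => /andP[xz zy] ->; exists z => //.
  by rewrite !ger0_norm ?subr_ge0 ?lerB// (le_trans xz).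
have [|z] := MVT_segment yx (fun t _ => fd t).
  exact: continuous_subspaceT.
rewrite in_itv/= => /andP[yz zx] e; exists z.
  by rewrite !ler0_norm ?subr_le0 ?lerN2 ?lerB// (le_trans yz).
by rewrite -[LHS]opprB e -mulrN opprB.
Qed.

(** A quadratic remainder is an inequality that can be summed term by term; superpositions are
    differentiated this way in [tame_series]. *)
Lemma is_derive_quadratic f (t g K : R) :
  (forall h, `|f (t + h) - f t - h * g| <= K * h ^+ 2) -> is_derive (t : R) (1 : R) f g.
Proof.
move=> hK.
have K0 : 0 <= K.
  by have := le_trans (normr_ge0 _) (hK 1); rewrite expr1n mulr1.
have lim_g : (fun h => h^-1 *: ((f \o shift t) (h *: (1 : R)) - f t)) @ 0^' --> g.
  apply/cvgrPdist_lt => e e0; near=> h.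
  have h0 : h != 0 by near: h; exact: nbhs_dnbhs_neq.
  rewrite /= [h *: 1]mulr1 [h + t]addrC.
  have -> : g - h^-1 *: (f (t + h) - f t) =
      - (h^-1 * (f (t + h) - f t - h * g)).
    by rewrite /GRing.scale/=; field.
  rewrite normrN normrM normfV mulrC ltr_pdivrMr ?normr_gt0//.
  apply: (le_lt_trans (hK h)).
  rewrite -real_normK ?num_real// expr2 mulrA ltr_pM2r ?normr_gt0//.
  have : `|h| < e / (K + 1).
    near: h; apply: dnbhs0_lt; rewrite divr_gt0//; lra.
  rewrite ltr_pdivlMr; last lra.
  by have := normr_ge0 h; lra.
by apply: DeriveDef; [exact: cvgP lim_g | exact: cvg_lim lim_g].
Unshelve. all: by end_near. Qed.

Lemma taylor2_le f df ddf (K : R) :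
  (forall t, is_derive (t : R) (1 : R) f (df t)) ->
  (forall t, is_derive (t : R) (1 : R) df (ddf t)) ->
  (forall t, `|ddf t| <= K) ->
  forall t h, `|f (t + h) - f t - h * df t| <= K * h ^+ 2.
Proof.
move=> fd dfd hK t h.
have [z hz ->] := MVT_dist t (t + h) fd.
have [w hw] := MVT_dist t z dfd.
have th : t + h - t = h by ring.
rewrite th in hz *; rewrite (mulrC (df z)) -mulrBr => ->.
rewrite !normrM -real_normK ?num_real// expr2 mulrCA.
by apply: ler_pM => //; rewrite ?mulr_ge0// ler_wpM2l.
Qed.

Lemma weighted_series_le c r (B : R) :
  (forall k, 0 <= c k) -> cvgn (series c) -> (forall k, `|r k| <= B) ->
  cvgn (series (fun k => c k * r k)) /\
  `|limn (series (fun k => c k * r k))| <= B * limn (series c).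
Proof.
move=> c0 cc hr.
have cB : cvgn (series (B *: c)) by exact: is_cvg_seriesZ.
have le_cB k : `|c k * r k| <= (B *: c) k.
  by rewrite normrM (ger0_norm (c0 k)) mulrC ler_wpM2r.
have cn : cvgn [normed series (fun k => c k * r k)].
  apply: series_le_cvg cB => k //=.
  exact: mulr_ge0 (le_trans (normr_ge0 _) (hr k)) (c0 k).
split; first exact: normed_cvg.
apply: (le_trans (lim_series_norm cn)).
have <- : limn (series (B *: c)) = B * limn (series c) by exact: lim_seriesZ.
exact: lim_series_le.
Qed.

End RealLemmas.

Section Tame.
Variable R : realType.
Implicit Types (U V : nat -> R -> R).

(* [U n] stands for the [n]-th Taylor coefficient [u^(n) / n!] of a positive
   function [u = U 0]; with this normalization the Leibniz rule is a plain
   convolution. *)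
Record tame (A : R) U : Prop := Tame {
  tame_gt0 : forall t, 0 < U 0 t ;
  tame_le : forall n t, `|U n t| <= A ^+ n * U 0 t ;
  tame_derive : forall n t, is_derive (t : R) (1 : R) (U n) (n.+1%:R * U n.+1 t) }.

Definition cosh_jet n (t : R) : R :=
  (n`!%:R)^-1 * (expR t + (-1) ^+ n * expR (- t)).

Lemma tame_cosh : tame 1 cosh_jet.
Proof.
split=> [t|n t|n t].
- by rewrite /cosh_jet fact0 invr1 expr0 !mul1r addr_gt0 ?expR_gt0.
- rewrite /cosh_jet expr1n mul1r fact0 invr1 expr0 !mul1r normrM.
  rewrite ger0_norm ?invr_ge0// -[leRHS]mul1r ler_pM// ?invr_ge0//.
    by rewrite invf_le1 ?ler1n ?ltr0n fact_gt0.
  rewrite (le_trans (ler_normD _ _))// normrM normrX normrN1 expr1n mul1r.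
  by rewrite !ger0_norm ?expR_ge0.
- have := fact_gt0 n; rewrite -(ltr0n R) => n0.
  have dN : is_derive (t : R) (1 : R) (fun x => expR (- x)) (- expR (- t)).
    by apply: is_derive_eq; rewrite mulrN1.
  have d := is_deriveZ (n`!%:R)^-1
    (is_deriveD (is_derive_expR t) (is_deriveZ ((-1) ^+ n) dN)).
  apply: (is_derive_eq d).
  rewrite /cosh_jet /GRing.scale/= factS natrM exprS.
  by field; rewrite gt_eqF//= addrC natr1 pnatr_eq0.
Qed.

End Tame.

Section TameClosure.
Variable R : realType.
Implicit Types (U V : nat -> R -> R).

Lemma tame_add A U V : tame A U -> tame A V ->
  tame A (fun n t => U n t + V n t).
Proof.
move=> tU tV; split=> [t|n t|n t].
- by rewrite addr_gt0 ?(tame_gt0 tU) ?(tame_gt0 tV).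
- by rewrite mulrDr (le_trans (ler_normD _ _))// lerD ?(tame_le tU) ?(tame_le tV).
- have := tame_derive tU n t; have := tame_derive tV n t => dV dU.
  by rewrite mulrDr; apply: is_deriveD.
Qed.

Lemma tame_shift A U x : tame A U -> tame A (fun n t => U n (t - x)).
Proof.
move=> tU; split=> [t|n t|n t]; rewrite ?(tame_gt0 tU) ?(tame_le tU)//.
have dU := tame_derive tU n (t - x).
have dx : is_derive (t : R) (1 : R) (fun s => s - x) 1.
  by apply: is_derive_eq; rewrite subr0.
by have := @is_derive1_comp _ _ (fun s => s - x) _ _ _ dU dx; rewrite mulr1.
Qed.

(** As the weights are nonnegative, the bound of each term by [U 0] can be summed without loss. The
    boundedness of [U 0] makes all [U n] bounded, so the Taylor remainders are at most [K h^2] with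
    [K] independent of the translation and can be summed too. *)
Lemma tame_series A U (M : R) (c x : R ^nat) : tame A U ->
  (forall t, U 0%N t <= M) -> (forall k, 0 <= c k) -> 0 < c 0%N ->
  cvgn (series c) ->
  tame A (fun n t => limn (series (fun k => c k * U n (t - x k)))).
Proof.
move=> tU UM c0 c00 cc.
have A0 : 0 <= A.
  have := le_trans (normr_ge0 _) (tame_le tU 1 0).
  by rewrite expr1 pmulr_lge0// (tame_gt0 tU).
have UnM n t : `|U n t| <= A ^+ n * M.
  by apply: (le_trans (tame_le tU n t)); rewrite ler_wpM2l ?exprn_ge0.
have cU n t : cvgn (series (fun k => c k * U n (t - x k))).
  by have [] := weighted_series_le c0 cc (fun k => UnM n (t - x k)).
split=> [t|n t|n t].
- apply: (@lt_le_trans _ _ (series (fun k => c k * U 0%N (t - x k)) 1)).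
    by rewrite /series/= big_nat1 mulr_gt0 ?(tame_gt0 tU).
  apply: nondecreasing_cvgn_le => //; apply: nondecreasing_series => k _ _.
  by rewrite mulr_ge0// ltW// (tame_gt0 tU).
- have cA : cvgn (series (fun k => A ^+ n * (c k * U 0%N (t - x k)))).
    exact: (is_cvg_seriesZ (k := A ^+ n) (cU 0%N t)).
  have le_n k : `|c k * U n (t - x k)| <= A ^+ n * (c k * U 0%N (t - x k)).
    by rewrite normrM (ger0_norm (c0 k)) mulrCA ler_wpM2l// (tame_le tU).
  have cn : cvgn [normed series (fun k => c k * U n (t - x k))].
    apply: series_le_cvg cA => // k.
      by rewrite /= normr_ge0.
    by rewrite mulr_ge0 ?exprn_ge0// mulr_ge0// ltW// (tame_gt0 tU).
  apply: (le_trans (lim_series_norm cn)).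
  rewrite -[leRHS](lim_seriesZ (A ^+ n) (cU 0%N t)).
  exact: lim_series_le.
- set K := n.+1%:R * (n.+2%:R * (A ^+ n.+2 * M)).
  pose r h k := U n (t + h - x k) - U n (t - x k) -
    h * (n.+1%:R * U n.+1 (t - x k)).
  have hr h k : `|r h k| <= K * h ^+ 2.
    rewrite /r (addrAC t h); apply: (@taylor2_le _ (U n) (fun t => n.+1%:R * U n.+1 t)
      (fun t => n.+1%:R * (n.+2%:R * U n.+2 t))).
    + by move=> s; exact: tame_derive tU _ _.
    + by move=> s; have := tame_derive tU n.+1 s => d1; exact: is_deriveZ.
    + move=> s; rewrite !normrM !(ger0_norm (ler0n _ _)) /K.
      by rewrite ler_wpM2l ?ler0n// ler_wpM2l ?ler0n.
  apply: (@is_derive_quadratic _ _ _ _ (K * limn (series c))) => h.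
  have [_] := weighted_series_le c0 cc (hr h).
  rewrite [K * _ * _]mulrAC; congr (_ <= _); congr `|_|.
  set f := fun k => c k * U n (t + h - x k).
  set g := fun k => c k * U n (t - x k).
  set g' := fun k => c k * U n.+1 (t - x k).
  have -> : (fun k => c k * r h k) = f - g - (h * n.+1%:R) *: g'.
    apply/funext => k; rewrite !fctE /f /g /g' /r /GRing.scale/=; ring.
  have cf : cvgn (series f) by exact: cU.
  have cg : cvgn (series g) by exact: cU.
  have cg' : cvgn (series g') by exact: cU.
  have cZ : cvgn (series ((h * n.+1%:R) *: g')) by exact: is_cvg_seriesZ.
  rewrite lim_seriesB//; last exact: is_cvg_seriesB.
  by rewrite lim_seriesB// lim_seriesZ// mulrA.
Qed.

(* Determined by [\sum_(b <= n) U (n - b) * inv_jet U b = (n == 0)]. *)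
Fixpoint inv_jet_seq U (n : nat) (t : R) : seq R :=
  if n is m.+1 then
    let s := inv_jet_seq U m t in
    rcons s (- (\sum_(b < n) U (n - b)%N t * s`_b) / U 0%N t)
  else [:: (U 0%N t)^-1].

Definition inv_jet U n t := (inv_jet_seq U n t)`_n.

Lemma size_inv_jet_seq U n t : size (inv_jet_seq U n t) = n.+1.
Proof. by elim: n => //= n IH; rewrite size_rcons IH. Qed.

Lemma nth_inv_jet_seq U n b t : (b <= n)%N ->
  (inv_jet_seq U n t)`_b = inv_jet U b t.
Proof.
elim: n => [|n IH]; first by rewrite leqn0 => /eqP->.
rewrite leq_eqVlt => /predU1P[->//|bn].
by rewrite /= nth_rcons size_inv_jet_seq bn IH.
Qed.

Lemma inv_jet0 U t : inv_jet U 0 t = (U 0%N t)^-1.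
Proof. by []. Qed.

Lemma inv_jetS U n t : inv_jet U n.+1 t =
  - (\sum_(b < n.+1) U (n.+1 - b)%N t * inv_jet U b t) / U 0%N t.
Proof.
rewrite [LHS]/inv_jet /= nth_rcons size_inv_jet_seq ltnn eqxx.
congr (- _ / _); apply: eq_bigr => b _; rewrite nth_inv_jet_seq//.
by rewrite -ltnS.
Qed.

(** By induction, the recursion bounds the coefficient of order [n > 0] by [\sum_(b < n) A^(n-b) (2
    A)^b = A^n (2^n - 1)] times [1 / U 0]; hence the doubled constant. The derivative relation
    follows by differentiating the recursion. *)
Lemma tame_inv A U : tame A U -> tame (2 * A) (inv_jet U).
Proof.
move=> tU; have U0 t := tame_gt0 tU t.
have U0' t : U 0%N t != 0 by rewrite gt_eqF.
have A0 : 0 <= A.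
  have := le_trans (normr_ge0 _) (tame_le tU 1 0).
  by rewrite expr1 pmulr_lge0.
have V0 t : 0 < inv_jet U 0 t by rewrite inv_jet0 invr_gt0.
split=> // n t.
- elim/ltn_ind: n => -[_|n IH]; first by rewrite expr0 mul1r ger0_norm// ltW.
  rewrite inv_jetS normrM normrN normfV [ `|U 0%N t|]ger0_norm ?(ltW (U0 t))//.
  rewrite ler_pdivrMr// -mulrA inv_jet0 mulVf// mulr1.
  apply: (le_trans (ler_norm_sum _ _ _)).
  apply: (@le_trans _ _ (\sum_(b < n.+1) A ^+ n.+1 * 2 ^+ b)).
    apply: ler_sum => b _; rewrite normrM.
    have := IH b (ltn_ord b); rewrite inv_jet0 => hV.
    apply: (le_trans (ler_pM _ _ (tame_le tU _ _) hV)) => //.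
    have -> : A ^+ (n.+1 - b) * U 0%N t * ((2 * A) ^+ b * (U 0%N t)^-1) =
        A ^+ (n.+1 - b) * (2 * A) ^+ b by field.
    by rewrite exprMn mulrCA -exprD subnK ?(ltnW (ltn_ord b))// mulrC.
  rewrite -mulr_sumr exprMn mulrC ler_wpM2r ?exprn_ge0//.
  have -> : \sum_(b < n.+1) 2 ^+ b = 2 ^+ n.+1 - 1 :> R.
    by rewrite [RHS]subrX1 addrK mul1r.
  by rewrite lerBlDr lerDl.
- elim/ltn_ind: n => -[_|n IH].
    have d0 := tame_derive tU 0 t.
    apply: (is_derive_eq (is_deriveV (U0' t) d0)).
    rewrite inv_jetS big_ord1 inv_jet0 subn0 /GRing.scale/=.
    by field.
  have d0 := is_deriveV (U0' t) (tame_derive tU 0 t).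
  have ds : is_derive (t : R) (1 : R)
      (\sum_(b < n.+1) (fun t => U (n.+1 - b)%N t * inv_jet U b t))
      (\sum_(b < n.+1) (((n.+1 - b).+1)%:R * U (n.+1 - b).+1 t * inv_jet U b t
          + U (n.+1 - b)%N t * (b.+1%:R * inv_jet U b.+1 t))).
    apply: is_derive_sum => b.
    have db := IH b (ltn_ord b).
    have dU := tame_derive tU (n.+1 - b)%N t.
    by apply: is_derive_eq; rewrite /GRing.scale/=; ring.
  have -> : inv_jet U n.+1 =
      - (\sum_(b < n.+1) (fun t => U (n.+1 - b)%N t * inv_jet U b t)) *
      (fun y => (U 0%N y)^-1).
    by apply/funext => s; rewrite inv_jetS !fctE fct_sumE.
  apply: (is_derive_eq (is_deriveM (is_deriveN ds) d0)).
  (* Write the factor [n + 2] as [(n + 2 - b) + b] in each term of the convolution. The term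
     [b = n + 1] of the first half is the isolated product; in the second half the term [b = 0]
     vanishes and the index shifts by one. *)
  have key : n.+2%:R * (\sum_(b < n.+2) U (n.+2 - b)%N t * inv_jet U b t) =
      U 1%N t * inv_jet U n.+1 t + \sum_(b < n.+1)
        ((n.+1 - b).+1%:R * U (n.+1 - b).+1 t * inv_jet U b t +
         U (n.+1 - b)%N t * (b.+1%:R * inv_jet U b.+1 t)).
    rewrite mulr_sumr big_split/= addrA.
    transitivity (\sum_(b < n.+2)
        ((n.+2 - b)%:R * U (n.+2 - b)%N t * inv_jet U b t +
         b%:R * U (n.+2 - b)%N t * inv_jet U b t)).
      apply: eq_bigr => b _; rewrite -!mulrA -mulrDl -natrD subnK//.
      by apply: ltnW; apply: ltn_ord.
    rewrite big_split/=; congr (_ + _).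
      rewrite big_ord_recr/= subSnn mul1r addrC; congr (_ + _).
      by apply: eq_bigr => b _; rewrite subSn ?(ltnW (ltn_ord b)).
    rewrite big_ord_recl/= !mul0r add0r; apply: eq_bigr => b _.
    by rewrite subSS -mulrA mulrCA.
  rewrite [in RHS]inv_jetS mulrA mulrN key.
  have -> : (- (\sum_(b < n.+1) (fun t => U (n.+1 - b)%N t * inv_jet U b t))) t =
      U 0%N t * inv_jet U n.+1 t.
    by rewrite inv_jetS !fctE fct_sumE mulrCA divff// mulr1.
  by rewrite /GRing.scale/=; field.
Qed.

End TameClosure.

(** * Rapidly decreasing majorants *)

Section Majorant.
Variable R : realType.

Lemma cvg_series_invsqr : cvgn (series (fun k : nat => (k.+1%:R ^+ 2)^-1 : R)).
Proof.
apply: nondecreasing_is_cvgn.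
  by apply: nondecreasing_series => k _ _; rewrite invr_ge0.
(* The sharper bound [2 - 2 / (n + 1)] on the partial sums is the one that an induction can
   carry. *)
exists 2 => _ [n _ <-]; apply: (@le_trans _ _ (2 - 2 / n.+1%:R)); last first.
  by rewrite gerBl.
rewrite seriesEnat /=; elim: n => [|n IH]; first by rewrite big_geq// divr1 subrr.
rewrite big_nat_recr//= -lerBrDr; apply: (le_trans IH).
rewrite -subr_ge0.
have n0 : 0 < n.+1%:R :> R by rewrite ltr0n.
have -> : 2 - 2 / n.+2%:R - (n.+1%:R ^+ 2)^-1 - (2 - 2 / n.+1%:R) =
   n%:R / (n.+1%:R ^+ 2 * n.+2%:R) :> R.
  rewrite -[n.+2%:R]natr1 -[n.+1%:R]natr1; rewrite -natr1 in n0.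
  by field; rewrite !gt_eqF//; lra.
by rewrite divr_ge0// mulr_ge0// exprn_ge0.
Qed.

Lemma weighted_series_ge (c r : R ^nat) k : (forall i, 0 <= c i * r i) ->
  cvgn (series (fun i => c i * r i)) ->
  c k * r k <= limn (series (fun i => c i * r i)).
Proof.
move=> cr0 cvg; apply: (@le_trans _ _ (series (fun i => c i * r i) k.+1)).
  rewrite seriesEnat /= big_nat_recr//= lerDr sumr_ge0//.
by apply: nondecreasing_cvgn_le => //; apply: nondecreasing_series.
Qed.

Variable omega : R -> R.
Hypothesis homega : nonquasianalytic_weight omega.

(** By [weight_gamma], [exp (- s omega k)] is at most a constant times [(k + 1)^(- s b)]; [s] is
    taken with [s b >= 2]. *)
Lemma weight_exp_summable : exists s : nat,
  cvgn (series (fun k : nat => expR (- (s%:R * omega k%:R)))).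
Proof.
have [a [b [b0 hab]]] := weight_gamma homega.
pose s := (Num.Def.truncn (2 / b)).+1.
have sb : 2 <= s%:R * b.
  by rewrite -ler_pdivrMr//; apply/ltW/truncnS_gt.
exists s; apply: (@series_le_cvg _ _
    (fun k : nat => expR (- (s%:R * a)) * (k.+1%:R ^+ 2)^-1)) => [k|k|k|].
- exact: expR_ge0.
- by rewrite mulr_ge0 ?expR_ge0// invr_ge0 exprn_ge0.
- have k0 : 0 < k.+1%:R :> R by rewrite ltr0n.
  rewrite -[k.+1%:R]lnK ?posrE// -expRM_natl -expRN -expRD ler_expR.
  have hk := hab k%:R (ler0n _ _); rewrite [1 + _]addrC natr1 in hk.
  have l0 : 0 <= ln k.+1%:R :> R by rewrite ln_ge0// ler1n.
  have s0 : 0 <= s%:R :> R by rewrite ler0n.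
  by have := ler_wpM2l s0 hk; nra.
- exact: (is_cvg_seriesZ (k := expR (- (s%:R * a))) cvg_series_invsqr).
Qed.

Definition sech_jet : nat -> R -> R := inv_jet (@cosh_jet R).

Lemma tame_sech : tame 2 sech_jet.
Proof. by have := tame_inv (tame_cosh R); rewrite mulr1. Qed.

Lemma sech0 (t : R) : sech_jet 0 t = (expR t + expR (- t))^-1.
Proof.
by rewrite /sech_jet inv_jet0 /cosh_jet fact0 invr1 expr0 !mul1r.
Qed.

Lemma sech0_le (t : R) : sech_jet 0 t <= expR (- `|t|).
Proof.
rewrite sech0 (expRN `|t|) lef_pV2 ?posrE ?expR_gt0 ?addr_gt0 ?expR_gt0//.
by have [_|_] := ger0P t; rewrite ?lerDl ?lerDr expR_ge0.
Qed.

Lemma sech0_ge (t : R) : `|t| <= 1 -> (2 * expR 1)^-1 <= sech_jet 0 t.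
Proof.
rewrite ler_norml => /andP[t1 t2].
rewrite sech0 lef_pV2 ?posrE ?addr_gt0 ?mulr_gt0 ?expR_gt0//.
by rewrite mulrDl !mul1r lerD// ler_expR; lra.
Qed.

(* [U 0] superposes translates of [1 / cosh] by the integers [k] and [- k],
   weighted by the infimum over [m] of [E m * exp (- m omega k)]. *)
Lemma tame_majorant (E : nat -> R) : (forall m, 1 <= E m) ->
  exists U : nat -> R -> R, [/\ tame 2 U,
    forall t z, (forall m, z <= E m * expR (- (m%:R * omega `|t|))) ->
      z <= U 0%N t &
    forall m : nat, exists C : R, forall t,
      expR (m%:R * omega `|t|) * U 0%N t <= C].
Proof.
move=> E1.
pose S (k : nat) := [set E m * expR (- (m%:R * omega k%:R)) | m in [set: nat]].
have Slb k : has_lbound (S k).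
  exists 0 => _ [m _ <-]; rewrite mulr_ge0 ?expR_ge0//.
  by apply: le_trans (E1 m); exact: ler01.
pose g k := inf (S k).
have S0 k : S k !=set0 by exists (E 0%N * expR (- (0%:R * omega k%:R))); exists 0%N.
have g0 k : 0 <= g k.
  apply: lb_le_inf => // _ [m _ <-]; rewrite mulr_ge0 ?expR_ge0//.
  by apply: le_trans (E1 m); exact: ler01.
have gE k m : g k <= E m * expR (- (m%:R * omega k%:R)).
  by apply: ge_inf => //; exists m.
(* As [E m >= 1] and [omega 0 = 0], the first weight is positive, which [tame_series] requires for a
   positive sum. *)
have g00 : 1 <= g 0%N.
  apply: lb_le_inf => // _ [m _ <-].
  by rewrite (weight_normalized homega) ?lexx ?ler01// mulr0 oppr0 expR0 mulr1.
(* [q] bounds [sech_jet 0] from below on [[-1, 1]], so the translate to [k] with weight [g k / q] is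
   at least [g k] within distance 1 of [k]. *)
pose q : R := (2 * expR 1)^-1.
have q0 : 0 < q by rewrite invr_gt0 mulr_gt0 ?expR_gt0.
pose c k := q^-1 * g k.
have c0 k : 0 <= c k by rewrite mulr_ge0 ?invr_ge0// ltW.
have c00 : 0 < c 0%N by rewrite mulr_gt0 ?invr_gt0// (lt_le_trans _ g00).
have [s hs] := weight_exp_summable.
(* Choosing [m > r + s] in the infimum leaves the summable factor [exp (- s omega k)] after
   [exp (r omega k)] has been paid for. *)
have cE (r : R) : 0 <= r -> exists2 D : R, 0 <= D &
    forall k, c k * expR (r * omega k%:R) <= D * expR (- (s%:R * omega k%:R)).
  move=> r0; pose m := ((Num.Def.truncn r).+1 + s)%N.
  have E0 : 0 <= E m by apply: le_trans (E1 m); exact: ler01.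
  exists (q^-1 * E m) => [|k].
    by rewrite mulr_ge0 ?invr_ge0// ltW.
  have w0 := weight_ge0 homega (ler0n _ k).
  rewrite /c -!mulrA ler_wpM2l ?invr_ge0 ?(ltW q0)//.
  rewrite -ler_pdivlMr ?expR_gt0//; apply: (le_trans (gE k m)).
  rewrite -mulrA -expRN -expRD ler_wpM2l// ler_expR /m natrD.
  by have := truncnS_gt r; nra.
have cc : cvgn (series c).
  have [D D0 hD] := cE 0 (lexx _).
  apply: (@series_le_cvg _ _ (fun k : nat => D * expR (- (s%:R * omega k%:R)))) => //.
  - by move=> k; rewrite mulr_ge0 ?expR_ge0.
  - by move=> k; have := hD k; rewrite mul0r expR0 mulr1.
  - exact: (is_cvg_seriesZ (k := D) hs).
have sM t : sech_jet 0 t <= 1.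
  by apply: (le_trans (sech0_le t)); rewrite -expR0 ler_expR oppr_le0.
pose W (e : R) n t := limn (series (fun k : nat => c k * sech_jet n (t - e * k%:R))).
have tW e : tame 2 (W e) by exact: (tame_series (fun k => e * k%:R) tame_sech sM).
have cW e t : cvgn (series (fun k : nat => c k * sech_jet 0 (t - e * k%:R))).
  have hr k : `|sech_jet 0 (t - e * k%:R)| <= 1.
    by rewrite ger0_norm// ltW// (tame_gt0 tame_sech).
  by have [] := weighted_series_le c0 cc hr.
exists (fun n t => W 1 n t + W (- 1) n t); split.
- exact: tame_add.
- move=> t z hz.
  have lowW (e : R) : `|e| = 1 -> e * t = `|t| -> z <= W e 0%N t.
    (* Rounding down gives [omega k <= omega |t|], so the decay assumed at [t] implies the one at
       [k], that is, [z <= g k]. *)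
    move=> e1 et; pose k := Num.Def.truncn `|t|.
    have /andP[kt tk] := truncn_itv (normr_ge0 t).
    have zg : z <= g k.
      apply: lb_le_inf => // _ [m _ <-]; apply: (le_trans (hz m)).
      rewrite ler_wpM2l ?ler_expR ?lerN2 ?ler_wpM2l ?weight_mono//.
      by apply: le_trans (E1 m); exact: ler01.
    apply: (le_trans zg).
    apply: (@le_trans _ _ (c k * sech_jet 0 (t - e * k%:R))); last first.
      apply: (@weighted_series_ge c (fun i => sech_jet 0 (t - e * i%:R))) => // i.
      by rewrite mulr_ge0// ltW// (tame_gt0 tame_sech).
    rewrite /c mulrC mulrA ler_peMl// ler_pdivlMr// mul1r; apply: sech0_ge.
    rewrite -[ `|_|]mul1r -e1 -normrM mulrBr et mulrA -expr2.
    rewrite -[e ^+ 2]real_normK ?num_real// e1 expr1n mul1r.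
    by rewrite ger0_norm ?subr_ge0// lerBlDl natr1 ltW.
  have Wge0 e : 0 <= W e 0%N t by rewrite ltW// (tame_gt0 (tW e)).
  have [t0|t0] := lerP 0 t.
    have := lowW 1; rewrite normr1 mul1r ger0_norm// => /(_ erefl erefl) h.
    by rewrite (le_trans h)// lerDl.
  have := lowW (- 1); rewrite normrN1 mulN1r ltr0_norm// => /(_ erefl erefl) h.
  by rewrite (le_trans h)// lerDr.
- move=> m; have [K K1 hK] := weight_alpha homega.
  have K0 : 0 <= K by lra.
  pose d := m%:R * K.
  have d0 : 0 <= d by rewrite mulr_ge0.
  have [D D0 hD] := cE d d0.
  (* With [y] the distance from [t] to the centre of a translate,
     [m omega |t| <= d + d omega y + d omega k]. The slope [1 / (d + 1)] makes
     [d omega y <= y + d C0], absorbed by the decay [exp (- y)] of the translate, and [cE] absorbs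
     [d omega k]. *)
  have e0 : 0 < (d + 1)^-1 by rewrite invr_gt0; lra.
  have [C0 C00 hC0] := weight_sublinear homega e0.
  set B := expR d * (expR (d * C0) * D).
  have B0 : 0 <= B by rewrite !mulr_ge0 ?expR_ge0.
  pose L := limn (series (fun k : nat => expR (- (s%:R * omega k%:R)))).
  have upW (e : R) t : `|e| = 1 -> expR (m%:R * omega `|t|) * W e 0%N t <= B * L.
    move=> e1.
    have term k : expR (m%:R * omega `|t|) * (c k * sech_jet 0 (t - e * k%:R)) <=
        B * expR (- (s%:R * omega k%:R)).
      set y := `|t - e * k%:R|.
      have y0 : 0 <= y by exact: normr_ge0.
      have tyk : `|t| <= y + k%:R.
        rewrite -[t in leLHS](subrK (e * k%:R)) (le_trans (ler_normD _ _))//.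
        by rewrite normrM e1 mul1r ger0_norm.
      have wy := weight_ge0 homega y0.
      have wk := weight_ge0 homega (ler0n R k).
      have wt : omega `|t| <= K * (1 + omega y + omega k%:R).
        have [yk|yk] := leP y k%:R.
          apply: (@le_trans _ _ (omega (2 * k%:R))).
            by apply: weight_mono => //; lra.
          by apply: (le_trans (hK _ (ler0n R k))); rewrite ler_wpM2l//; lra.
        apply: (@le_trans _ _ (omega (2 * y))).
          by apply: weight_mono => //; lra.
        by apply: (le_trans (hK _ y0)); rewrite ler_wpM2l//; lra.
      have m0 : 0 <= m%:R :> R by [].
      have wt' : m%:R * omega `|t| <= d + d * omega y + d * omega k%:R.
        by apply: (le_trans (ler_wpM2l m0 wt)); rewrite /d; lra.
      have dy : d * omega y - y <= d * C0.
        have h := ler_wpM2l d0 (hC0 y y0).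
        have : d * ((d + 1)^-1 * y) <= y.
          rewrite mulrA ler_piMl// ler_pdivrMr ?mul1r; lra.
        by move: h; rewrite mulrDr; lra.
      apply: (@le_trans _ _ (expR (d + d * omega y + d * omega k%:R) *
          (c k * expR (- y)))).
        apply: ler_pM; [exact: expR_ge0| |by rewrite ler_expR|].
          by rewrite mulr_ge0// ltW// (tame_gt0 tame_sech).
        by rewrite ler_wpM2l// sech0_le.
      have -> : expR (d + d * omega y + d * omega k%:R) * (c k * expR (- y)) =
          expR d * (expR (d * omega y - y) * (c k * expR (d * omega k%:R))).
        by rewrite !expRD; ring.
      rewrite /B -(mulrA (expR d)) ler_wpM2l ?expR_ge0// -(mulrA (expR (d * C0))).
      apply: ler_pM; [exact: expR_ge0| |by rewrite ler_expR|exact: hD].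
      by rewrite mulr_ge0// expR_ge0.
    rewrite /W /L -[leLHS](lim_seriesZ (expR (m%:R * omega `|t|)) (cW e t)).
    rewrite -[leRHS](lim_seriesZ B hs).
    apply: lim_series_le; [exact: is_cvg_seriesZ|exact: is_cvg_seriesZ|].
    exact: term.
  exists (B * L + B * L) => t.
  by rewrite mulrDr lerD// upW// ?normrN normr1.
Qed.

End Majorant.

(** * Locally convex topologies *)

Section SeminormTopologyTheory.
Context {K : numDomainType} {V : lmodType K} {R : realType}.
Variables (X : set V) (P : set (V -> \bar R)).

Lemma cvg_lcspace (F : set_system (lcspace X P)) (z : lcspace X P) : Filter F ->
  (forall p f0 e, P p -> 0 < e -> @seminorm_ball K V R X P p f0 e z ->
    F (@seminorm_ball K V R X P p f0 e)) -> F --> z.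
Proof.
move=> FF hF A /=; rewrite nbhsE.
move=> [_ [[B sB <-] [C BC Ct] sUBA]].
rewrite nbhs_filterE; apply: filterS sUBA _; apply: (@filterS _ _ _ C).
  by move=> ? ?; exists C.
have /sB [D sD IDeC] := BC; rewrite -IDeC; apply: filter_bigI => E DE.
have /sD /set_mem [p [f0 [e [Pp e0 Ee]]]] := DE.
rewrite Ee; apply: hF => //; rewrite -Ee.
by move: Ct; rewrite -IDeC => /(_ _ DE).
Qed.

Lemma nbhs_seminorm_ball p (f0 : lcspace X P) e (z : lcspace X P) : P p ->
  0 < e -> seminorm_ball p f0 e z -> nbhs z (seminorm_ball p f0 e).
Proof.
move=> Pp e0 bz; rewrite nbhsE; exists (seminorm_ball p f0 e) => //; split => //.
exists [set (seminorm_ball p f0 e : set (lcspace X P))]; last exact: bigcup_set1.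
move=> _ ->; exists [fset (seminorm_ball p f0 e : set (lcspace X P))]%fset.
  by move=> U; rewrite in_fset1 => /eqP->; apply/mem_set; exists p, f0, e.
rewrite predeqE => x; split=> [h|bx i].
  by apply: (h (seminorm_ball p f0 e)); rewrite /= in_fset1.
by rewrite /= in_fset1 => /eqP->.
Qed.

End SeminormTopologyTheory.

Section SeminormTopologyComparison.
Context {K : numDomainType} {V : lmodType K} {R : realType}.
Variables (X : set V) (P P' : set (V -> \bar R)).

(** The subbasic balls have arbitrary centres, hence the triangle inequality for differences. The
    condition on [p0 0] puts each point into its own ball. *)
Lemma lcspace_id_continuous :
  (forall p, P' p ->
    (forall f g h, X f -> X g -> X h -> (p (f - h)%R <= p (f - g)%R + p (g - h)%R)%E) /\
    exists p0 C, [/\ P p0, 0 < C, (p0 0%R <= 0)%E &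
      forall f g, X f -> X g -> (p (f - g)%R <= C%:E * p0 (f - g)%R)%E]) ->
  continuous (fun f : lcspace X P => f : lcspace X P').
Proof.
move=> h f1; apply: cvg_lcspace.
  exact: (@fmap_filter _ _ _ _ (@nbhs_filter (lcspace X P) f1)).
move=> p f0 e /h[pD [p0 [C [Pp0 C0 p00 hC]]]] e0 f1e.
have Xv (f : lcspace X P) : X (\val f) by exact: set_valP.
have {}f1e : (p (\val f1 - \val f0)%R < e%:E)%E by [].
(* The functionals take extended values: [p (f1 - f0)] may be [-oo], as for a supremum over an empty
   set, and then any radius will do. *)
suff [d d0 hd] : exists2 d, 0 < d & forall x : \bar R, (x < (C * d)%:E)%E ->
    (x + p (\val f1 - \val f0)%R < e%:E)%E.
  have : nbhs f1 (@seminorm_ball K V R X P p0 f1 d).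
    apply: nbhs_seminorm_ball => //; rewrite /seminorm_ball /= subrr.
    by rewrite (le_lt_trans p00)// lte_fin.
  apply: filterS => f; rewrite /seminorm_ball /= => fd.
  apply: (le_lt_trans (pD _ _ _ (Xv f) (Xv f1) (Xv f0))); apply: hd.
  apply: (le_lt_trans (hC _ _ (Xv f) (Xv f1))).
  by rewrite EFinM lte_pmul2l.
move: f1e; case: (p _) => [r| |]//; rewrite ?lte_fin.
  move=> re; exists ((e - r) / C); first by rewrite divr_gt0// subr_gt0.
  case=> [x| |]//; rewrite ?lte_fin ?ltNyr// -?EFinD ?lte_fin ?addNye ?ltNyr//.
  by rewrite mulrC divfK ?gt_eqF//; lra.
by move=> _; exists 1 => // x _; rewrite addeNy ltNyr.
Qed.

Lemma lc_bounded_continuous (B : set X) :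
  continuous (fun f : lcspace X P => f : lcspace X P') ->
  lc_bounded X P B -> lc_bounded X P' B.
Proof. by move=> ct hB z z0 U Uz; apply: (hB z z0); exact: (ct z). Qed.

End SeminormTopologyComparison.

(** The curve [t *: g] tends to the origin as [t] tends to 0, so it enters every neighbourhood. This
    is what makes each tau_s seminorm a tau_b seminorm, with [B = [set g]]. *)
Lemma lc_bounded_set1 (R : realType) (V : lmodType R[i]) (X : set V)
    (P : set (V -> \bar R)) (g : lcspace X P) :
  (forall t : R, X (t%:C%C *: \val g)) ->
  (forall p, P p -> exists2 M : R, 0 <= M & forall f t, X f ->
     (p (t%:C%C *: \val g - f)%R <= (`|t| * M)%:E + p (0 - f)%R)%E) ->
  lc_bounded X P [set g].
Proof.
move=> Xg hP z z0 U Uz.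
pose psi (t : R) : lcspace X P := exist _ (t%:C%C *: \val g) (mem_set (Xg t)).
have cpsi : psi @ (0 : R) --> z.
  apply: cvg_lcspace; first exact: (@fmap_filter _ _ _ _ (@nbhs_filter R 0)).
  move=> p f0 e Pp e0; rewrite {1}/seminorm_ball /= z0 => hz.
  have [M M0 hM] := hP p Pp.
  have [d d0 hd] : exists2 d, 0 < d & forall x : R, x < d ->
      (x%:E + p (0 - \val f0)%R < e%:E)%E.
    move: hz; case: (p _) => [r| |]//; rewrite ?lte_fin.
      move=> re; exists (e - r); first by rewrite subr_gt0.
      by move=> x; rewrite ?lte_fin -?EFinD ?lte_fin; lra.
    by move=> _; exists 1 => // x _; rewrite addeNy ltNyr.
  have dM : 0 < d / (M + 1) by rewrite divr_gt0//; lra.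
  apply/nbhs_ballP; exists (d / (M + 1)) => // t; rewrite /ball/= sub0r normrN.
  move=> td; apply: (le_lt_trans (hM _ t (set_valP f0))); apply: hd.
  move: td; rewrite ltr_pdivlMr; last lra.
  by have := normr_ge0 t; nra.
have /cpsi /nbhs_ballP [d /= d0 hd] := Uz.
have d2 : 0 < d / 2 by rewrite divr_gt0.
exists ((d / 2)^-1)%:C%C; first by rewrite ltcR invr_gt0.
move=> _ ->; exists (psi (d / 2)).
  by apply: hd; rewrite /ball/= sub0r normrN gtr0_norm//; lra.
by rewrite /= scalerA -rmorphM mulVf ?gt_eqF// scale1r.
Qed.

(** * Calculus of complex functions *)

Section ComplexFunctions.
Variables (R : realType) (N : nat).
Implicit Types (f g h : Efun R N) (x : 'rV[R]_N) (j : 'I_N) (s t : seq 'I_N).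

Lemma modulus_add (z w : R[i]) : modulus (z + w) <= modulus z + modulus w.
Proof. exact: le_normcD. Qed.

Lemma modulus_mul (z w : R[i]) : modulus (z * w) = modulus z * modulus w.
Proof. exact: ComplexField.Normc.normcM. Qed.

Lemma modulus_ge0 (z : R[i]) : 0 <= modulus z.
Proof. by case: z => a b; exact: sqrtr_ge0. Qed.

Lemma modulus0 : modulus (0 : R[i]) = 0.
Proof. exact: ComplexField.Normc.normc0. Qed.

Lemma modulus_real (a : R) : modulus (a%:C%C) = `|a|.
Proof. by rewrite /modulus /= expr0n /= addr0 sqrtr_sqr. Qed.

(* What [smooth] requires of each iterated partial derivative. *)
Definition dirdiff f : Prop :=
  [/\ continuous (fun y => complex.Re (f y)),
      continuous (fun y => complex.Im (f y)) &
   forall x j, derivable (fun y => complex.Re (f y)) x (delta_mx 0 j) /\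
               derivable (fun y => complex.Im (f y)) x (delta_mx 0 j)].

Lemma smooth_dirdiff f : smooth f -> dirdiff f.
Proof. by move/(_ [::]). Qed.

Lemma partials_rcons s j f : partials (rcons s j) f = partials s (partial j f).
Proof. by rewrite /partials foldr_rcons. Qed.

Lemma smooth_partial j f : smooth f -> smooth (partial j f).
Proof. by move=> sf s; rewrite /= -partials_rcons; exact: sf. Qed.

(** A coinduction principle: smoothness is proved by exhibiting a class of directionally
    differentiable functions that is stable under [partial]. *)
Lemma smooth_coind (P : Efun R N -> Prop) :
  (forall f, P f -> dirdiff f /\ forall j, P (partial j f)) ->
  forall f, P f -> smooth f.
Proof.
move=> hP f Pf s /=; suff /hP[] : P (partials s f) by [].
by elim: s => //= j s /hP[_].
Qed.

Let reim (u v : 'rV[R]_N -> R) : Efun R N := fun y => Complex (u y) (v y).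

Let dirdiff_reim (u v : 'rV[R]_N -> R) (du dv : 'rV[R]_N -> 'I_N -> R) :
  continuous u -> continuous v ->
  (forall x j, is_derive x (delta_mx 0 j : 'rV[R]_N) u (du x j)) ->
  (forall x j, is_derive x (delta_mx 0 j : 'rV[R]_N) v (dv x j)) ->
  dirdiff (reim u v) /\
  forall j, partial j (reim u v) = reim (du^~ j) (dv^~ j).
Proof.
move=> cu cv hu hv; split.
  split; [exact: cu|exact: cv|move=> x j; split].
    exact: (@ex_derive _ _ _ _ _ _ _ (hu x j)).
  exact: (@ex_derive _ _ _ _ _ _ _ (hv x j)).
move=> j; apply/funext => x; rewrite /partial /reim.
rewrite /= (@derive_val _ _ _ _ _ _ _ (hu x j)).
by rewrite (@derive_val _ _ _ _ _ _ _ (hv x j)).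
Qed.

Let dirdiff_exP f : dirdiff f -> exists u v du dv,
  [/\ f = reim u v, continuous u, continuous v &
   [/\ (forall x j, is_derive x (delta_mx 0 j : 'rV[R]_N) u (du x j)),
   (forall x j, is_derive x (delta_mx 0 j : 'rV[R]_N) v (dv x j)) &
   (forall j, partial j f = reim (du^~ j) (dv^~ j))]].
Proof.
move=> [cR cI d].
exists (fun y => complex.Re (f y)), (fun y => complex.Im (f y)).
exists (fun x j => 'D_(delta_mx 0 j) (fun y => complex.Re (f y)) x).
exists (fun x j => 'D_(delta_mx 0 j) (fun y => complex.Im (f y)) x).
split=> //; first by apply/funext => y; rewrite /reim; case: (f y).
split; [move=> x j|move=> x j|by []].
  by have [dR _] := d x j; exact: (DeriveDef dR erefl).
by have [_ dI] := d x j; exact: (DeriveDef dI erefl).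
Qed.

Let dirdiffD_partial f g : dirdiff f -> dirdiff g -> dirdiff (f + g) /\
  forall j, partial j (f + g) = partial j f + partial j g.
Proof.
move=> /dirdiff_exP[u [v [du [dv [-> cu cv [hu hv ef]]]]]].
move=> /dirdiff_exP[w [z [dw [dz [-> cw cz [hw hz eg]]]]]].
have -> : reim u v + reim w z = reim (u + w) (v + z) by [].
have [d p] := dirdiff_reim
  (fun x => cvgD (cu x) (cw x) : {for x, continuous (u + w)})
  (fun x => cvgD (cv x) (cz x) : {for x, continuous (v + z)})
  (fun x j => is_deriveD (hu x j) (hw x j))
  (fun x j => is_deriveD (hv x j) (hz x j)).
by split; [exact: d|move=> j; rewrite p ef eg].
Qed.

Let dirdiffM_partial f g : dirdiff f -> dirdiff g -> dirdiff (mulE f g) /\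
  forall j, partial j (mulE f g) = mulE (partial j f) g + mulE f (partial j g).
Proof.
move=> /dirdiff_exP[u [v [du [dv [-> cu cv [hu hv ef]]]]]].
move=> /dirdiff_exP[w [z [dw [dz [-> cw cz [hw hz eg]]]]]].
have -> : mulE (reim u v) (reim w z) = reim (u * w - v * z) (u * z + v * w) by [].
have [d p] := dirdiff_reim
  (fun x => cvgB (cvgM (cu x) (cw x)) (cvgM (cv x) (cz x)) :
    {for x, continuous (u * w - v * z)})
  (fun x => cvgD (cvgM (cu x) (cz x)) (cvgM (cv x) (cw x)) :
    {for x, continuous (u * z + v * w)})
  (fun x j => is_deriveB (is_deriveM (hu x j) (hw x j)) (is_deriveM (hv x j) (hz x j)))
  (fun x j => is_deriveD (is_deriveM (hu x j) (hz x j)) (is_deriveM (hv x j) (hw x j))).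
split; [exact: d|move=> j; rewrite p ef eg; apply/funext => x].
apply/eqP; rewrite eq_complex; apply/andP.
by split; apply/eqP; rewrite /= /GRing.scale/=; ring.
Qed.

Lemma dirdiffD f g : dirdiff f -> dirdiff g -> dirdiff (f + g).
Proof. by move=> df dg; have [] := dirdiffD_partial df dg. Qed.

Lemma partialD j f g : dirdiff f -> dirdiff g ->
  partial j (f + g) = partial j f + partial j g.
Proof. by move=> df dg; have [_] := dirdiffD_partial df dg. Qed.

Lemma dirdiffM f g : dirdiff f -> dirdiff g -> dirdiff (mulE f g).
Proof. by move=> df dg; have [] := dirdiffM_partial df dg. Qed.

Lemma partialM j f g : dirdiff f -> dirdiff g ->
  partial j (mulE f g) = mulE (partial j f) g + mulE f (partial j g).
Proof. by move=> df dg; have [_] := dirdiffM_partial df dg. Qed.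

(** Products alone are not stable under [partial]; closed under sums, they are, by the product rule,
    and form an invariant for [smooth_coind]. *)
Inductive sum_of_products : Efun R N -> Prop :=
| sum_of_products_mul f g :
    smooth f -> smooth g -> sum_of_products (mulE f g)
| sum_of_products_add f g :
    sum_of_products f -> sum_of_products g -> sum_of_products (f + g).

Lemma smoothM f g : smooth f -> smooth g -> smooth (mulE f g).
Proof.
move=> sf sg; apply: (smooth_coind _ (sum_of_products_mul sf sg)).
move=> {sf sg g} {}f; elim=> {f} [f g sf sg|f g _ [df sf] _ [dg sg]].
  have [df dg] := (smooth_dirdiff sf, smooth_dirdiff sg).
  split=> [|j]; first exact: (dirdiffM df dg).
  rewrite (partialM j df dg).
  exact: (sum_of_products_add (sum_of_products_mul (smooth_partial j sf) sg)
    (sum_of_products_mul sf (smooth_partial j sg))).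
split=> [|j]; first exact: (dirdiffD df dg).
by rewrite (partialD j df dg); exact: (sum_of_products_add (sf j) (sg j)).
Qed.

Lemma smoothD f g : smooth f -> smooth g -> smooth (f + g).
Proof.
move=> sf sg; apply: (@smooth_coind
  (fun h => exists f g, [/\ smooth f, smooth g & h = f + g])); last by exists f, g.
move=> _ [{}f [{}g [{}sf {}sg ->]]].
have [df dg] := (smooth_dirdiff sf, smooth_dirdiff sg).
split=> [|j]; first exact: (dirdiffD df dg).
exists (partial j f), (partial j g); rewrite (partialD j df dg).
by split; [exact: (smooth_partial j sf)|exact: (smooth_partial j sg)|].
Qed.

Lemma dirdiff_cst (c : R[i]) : dirdiff (fun _ => c).
Proof.
split=> [x|x|x j].
- exact: (@cst_continuous _ _ (complex.Re c) x).
- exact: (@cst_continuous _ _ (complex.Im c) x).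
split; first exact: (derivable_cst (complex.Re c)).
exact: (derivable_cst (complex.Im c)).
Qed.

Lemma partial_cst j (c : R[i]) : partial j (fun _ => c) = fun _ => 0.
Proof. by apply/funext => x; rewrite /partial !derive_cst. Qed.

Lemma smooth_cst (c : R[i]) : smooth ((fun _ => c) : Efun R N).
Proof.
apply: (@smooth_coind (fun h => exists c, h = fun _ => c)); last by exists c.
move=> _ [{}c ->]; split=> [|j]; first exact: dirdiff_cst.
by exists 0; rewrite partial_cst.
Qed.

Lemma scaleE (c : R[i]) f : c *: f = mulE (fun _ => c) f.
Proof. by []. Qed.

Lemma smoothZ (c : R[i]) f : smooth f -> smooth (c *: f).
Proof. by move=> sf; rewrite scaleE; exact: (smoothM (smooth_cst c) sf). Qed.

Lemma partialZ j (c : R[i]) f : dirdiff f -> partial j (c *: f) = c *: partial j f.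
Proof.
move=> df; rewrite scaleE (partialM j (dirdiff_cst c) df) partial_cst.
by apply/funext => x; rewrite !fctE /mulE mul0r add0r.
Qed.

Lemma partials_smooth s f : smooth f -> smooth (partials s f).
Proof.
by move=> sf; elim: s => [|j s /= h]; [exact: sf|exact: (smooth_partial j h)].
Qed.

Lemma partialsD s f g : smooth f -> smooth g ->
  partials s (f + g) = partials s f + partials s g.
Proof.
move=> sf sg; elim: s => [//|j s /= ->].
by rewrite (partialD j (smooth_dirdiff (partials_smooth s sf))
  (smooth_dirdiff (partials_smooth s sg))).
Qed.

Lemma partialsZ s (c : R[i]) f : smooth f ->
  partials s (c *: f) = c *: partials s f.
Proof.
move=> sf; elim: s => [//|j s /= ->].
by rewrite (partialZ j c (smooth_dirdiff (partials_smooth s sf))).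
Qed.

Lemma smoothB f g : smooth f -> smooth g -> smooth (f - g).
Proof. by move=> sf sg; rewrite -scaleN1r; exact: (smoothD sf (smoothZ (-1) sg)). Qed.

Lemma partials0 s : partials s (0 : Efun R N) = 0.
Proof.
by have := partialsZ s 0 (smooth_cst 0); rewrite !scale0r.
Qed.

(* Leibniz' rule as an estimate: the [2 ^ size s] terms of the expansion are
   indexed by the pairs of complementary subsequences of [s]. *)
Lemma leibniz_le s f g x (c W : R) : smooth f -> smooth g -> 0 <= c ->
  (forall t1 t2, subseq t1 s -> subseq t2 s -> (size t1 + size t2 = size s)%N ->
     c * (modulus (partials t1 f x) * modulus (partials t2 g x)) <= W) ->
  c * modulus (partials s (mulE f g) x) <= 2 ^+ size s * W.
Proof.
move=> + + c0; elim/last_ind: s f g => [|s j IH] f g sf sg hW.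
  by rewrite expr0 mul1r /= /mulE modulus_mul; exact: (hW [::] [::]).
have [df dg] := (smooth_dirdiff sf, smooth_dirdiff sg).
have [sf' sg'] := (smooth_partial j sf, smooth_partial j sg).
rewrite partials_rcons (partialM j df dg).
rewrite (partialsD s (smoothM sf' sg) (smoothM sf sg')).
apply: (le_trans (ler_wpM2l c0 (modulus_add _ _))).
rewrite size_rcons exprS mulrDr -mulrA mulr_natl mulr2n; apply: lerD.
  apply: (IH _ _ sf' sg) => t1 t2 s1 s2 e; rewrite -partials_rcons; apply: hW.
  - by rewrite -!cats1 cat_subseq.
  - exact: subseq_trans (subseq_rcons _ _).
  - by rewrite !size_rcons addSn e.
apply: (IH _ _ sf sg') => t1 t2 s1 s2 e; rewrite -partials_rcons; apply: hW.
- exact: subseq_trans (subseq_rcons _ _).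
- by rewrite -!cats1 cat_subseq.
- by rewrite !size_rcons addnS e.
Qed.

Definition multiindex_seq (a : multiindex N) : seq 'I_N :=
  flatten [seq nseq (a j) j | j <- enum 'I_N].

Lemma mderivE a f : mderiv a f = partials (multiindex_seq a) f.
Proof.
rewrite /mderiv /multiindex_seq; elim: (enum _) => //= j e ->.
rewrite /partials foldr_cat.
by elim: (a j) => //= n ->.
Qed.

Lemma size_multiindex_seq a : size (multiindex_seq a) = mlength a.
Proof.
rewrite size_flatten /shape -map_comp sumnE big_map /mlength big_enum/=.
by apply: eq_bigr => j _; rewrite /= size_nseq.
Qed.

Let leI (i j : 'I_N) := (i <= j)%N.

Let leI_trans : transitive leI.
Proof. by move=> j i k; exact: leq_trans. Qed.

Lemma count_multiindex_seq a i : count_mem i (multiindex_seq a) = a i.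
Proof.
rewrite count_flatten -map_comp sumnE big_map.
rewrite (bigD1_seq i) ?enum_uniq ?mem_enum//= count_nseq/= eqxx mul1n.
rewrite big1 ?addn0// => j ji; rewrite count_nseq/=.
by rewrite (negPf ji) mul0n.
Qed.

Lemma sorted_multiindex_seq a : sorted leI (multiindex_seq a).
Proof.
rewrite (sorted_pairwise leI_trans) /multiindex_seq.
have : pairwise leI (enum 'I_N).
  rewrite -(sorted_pairwise leI_trans).
  have := iota_sorted 0 N; rewrite -val_enum_ord sorted_map.
  by apply: sub_sorted.
elim: (enum _) => //= j e IH /andP[je pe].
rewrite pairwise_cat IH// andbT; apply/andP; split.
  apply/allrelP => i k; rewrite mem_nseq => /andP[_ /eqP->].
  move=> /flattenP[_ /mapP[l le ->]]; rewrite mem_nseq => /andP[_ /eqP->].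
  by move/allP: je; apply.
by elim: (a j) => //= n ->; rewrite andbT; apply/allP => i;
   rewrite mem_nseq => /andP[_ /eqP->]; rewrite /leI.
Qed.

(** A subsequence of a sorted sequence is sorted, and a sorted sequence is determined by its
    multiplicities. Hence all terms in the Leibniz expansion of [mderiv a] are again of the form
    [mderiv b]. *)
Lemma subseq_multiindex_seq a t : subseq t (multiindex_seq a) ->
  exists b, t = multiindex_seq b.
Proof.
move=> ta; exists (fun i => count_mem i t).
apply: (sorted_eq leI_trans).
- by move=> i k /anti_leq /val_inj.
- exact: subseq_sorted ta (sorted_multiindex_seq a).
- exact: sorted_multiindex_seq.
- by apply/allP => i _ /=; rewrite count_multiindex_seq.
Qed.

(** The number of terms of the expansion is moved to the side of the weight, where [conj_weight_mul]
    with [A = 2] absorbs it. *)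
Lemma mderiv_leibniz_le a f g x (c W : R) : smooth f -> smooth g -> 0 <= c ->
  (forall b b', (mlength b + mlength b' = mlength a)%N ->
     2 ^+ mlength a * c *
       (modulus (mderiv b f x) * modulus (mderiv b' g x)) <= W) ->
  c * modulus (mderiv a (mulE f g) x) <= W.
Proof.
move=> sf sg c0 hW.
have p2 : 0 < 2 ^+ size (multiindex_seq a) :> R by rewrite exprn_gt0.
have -> : W = 2 ^+ size (multiindex_seq a) * (W / 2 ^+ size (multiindex_seq a)).
  by rewrite mulrCA divff ?gt_eqF// mulr1.
rewrite mderivE; apply: (leibniz_le sf sg c0) => t1 t2 s1 s2.
have [b1 e1] := subseq_multiindex_seq s1; have [b2 e2] := subseq_multiindex_seq s2.
rewrite e1 e2 -!mderivE ler_pdivlMr// !size_multiindex_seq => /hW.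
by rewrite -mulrA mulrC.
Qed.

Lemma mderivD a f g : smooth f -> smooth g ->
  mderiv a (f + g) = mderiv a f + mderiv a g.
Proof. by rewrite !mderivE; exact: partialsD. Qed.

Lemma mderivZ a (c : R[i]) f : smooth f -> mderiv a (c *: f) = c *: mderiv a f.
Proof. by rewrite !mderivE; exact: partialsZ. Qed.

Lemma mderiv0 a : mderiv a (0 : Efun R N) = 0.
Proof. by rewrite !mderivE; exact: partials0. Qed.

End ComplexFunctions.

(** * Products of one-dimensional functions *)

Section ProductJets.
Variables (R : realType) (N : nat).

Lemma is_derive_line (V : normedModType R) (F : V -> R) (x v : V) (d : R) :
  is_derive (0 : R) (1 : R) (fun h : R => F (h *: v + x)) d -> is_derive x v F d.
Proof.
case=> Fd <-; apply: DeriveDef; first exact/derivable1P.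
rewrite !/(derive _ _ _); set g1 := fun h => h^-1 *: _; set g2 := fun h => h^-1 *: _.
suff -> : g1 = g2 by [].
by apply/funext => h; rewrite /g1 /g2 /= addr0 scale0r add0r [_%:A]mulr1.
Qed.

Lemma continuous_prod (T : topologicalType) (I : Type) (r : seq I)
    (G : I -> T -> R) : (forall i, continuous (G i)) ->
  continuous (fun y => \prod_(i <- r) G i y).
Proof.
move=> cG; elim: r => [|i r IH] x.
  by under eq_fun do rewrite big_nil; exact: cvg_cst.
under eq_fun do rewrite big_cons.
exact: (cvgM (cG i x) (IH x)).
Qed.

Variables (A : R) (U : nat -> R -> R).
Hypothesis tU : tame A U.
Implicit Types (c : R) (b : 'I_N -> nat).

Definition prod_jet c b : Efun R N :=
  fun x => (c * \prod_i U (b i) (x 0 i))%:C%C.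

Lemma prod_jet_line c b j (x : 'rV[R]_N) :
  is_derive x (delta_mx 0 j) (fun y : 'rV[R]_N => c * \prod_i U (b i) (y 0 i))
    (c * (b j).+1%:R * \prod_i U (b i + (i == j))%N (x 0 i)).
Proof.
apply: is_derive_line.
have -> : (fun h : R => c * \prod_i U (b i) ((h *: delta_mx 0 j + x) 0 i)) =
    (c * \prod_(i | i != j) U (b i) (x 0 i)) *: (fun h => U (b j) (h - - x 0 j)).
  apply/funext => h; rewrite (bigD1 j)//= !fctE /GRing.scale/=.
  rewrite !mxE !eqxx /= mulr1 opprK mulrCA mulrC; congr (_ * _).
  congr (_ * _); apply: eq_bigr => i ij.
  by rewrite !mxE eqxx (negPf ij) /= mulr0 add0r.
have dU := tame_derive (tame_shift (- x 0 j) tU) (b j) 0.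
apply: (is_derive_eq (is_deriveZ (c * \prod_(i | i != j) U (b i) (x 0 i)) dU)).
rewrite [in RHS](bigD1 j)//= eqxx addn1 opprK add0r.
rewrite /GRing.scale/= -!mulrA; congr (_ * _).
rewrite mulrC -!mulrA; congr (_ * _); congr (_ * _).
by apply: eq_bigr => i ij; rewrite (negPf ij) addn0.
Qed.

Lemma dirdiff_prod_jet c b : dirdiff (prod_jet c b).
Proof.
have cU n : continuous (U n).
  move=> t; apply/differentiable_continuous/derivable1_diffP.
  exact: (@ex_derive _ _ _ _ _ _ _ (tame_derive tU n t)).
have cF : continuous (fun y : 'rV[R]_N => c * \prod_i U (b i) (y 0 i)).
  move=> x; apply: (cvgM (@cst_continuous _ _ c x)).
  apply: (@continuous_prod _ _ _ (fun i (y : 'rV[R]_N) => U (b i) (y 0 i))) => i y.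
  exact: (continuous_comp (@coord_continuous _ _ _ 0 i y) (cU (b i) (y 0 i))).
split=> [|x|x j].
- exact: cF.
- exact: (@cst_continuous _ _ (0 : R) x).
split; last exact: (derivable_cst (0 : R)).
exact: (@ex_derive _ _ _ _ _ _ _ (prod_jet_line c b j x)).
Qed.

Lemma partial_prod_jet c b j : partial j (prod_jet c b) =
  prod_jet (c * (b j).+1%:R) (fun i => b i + (i == j))%N.
Proof.
apply/funext => x; rewrite /partial /prod_jet /= derive_cst.
by rewrite (@derive_val _ _ _ _ _ _ _ (prod_jet_line c b j x)).
Qed.

Lemma smooth_prod_jet c b : smooth (prod_jet c b).
Proof.
apply: (@smooth_coind _ _ (fun h => exists c b, h = prod_jet c b)); last by exists c, b.
move=> _ [{}c [{}b ->]]; split=> [|j]; first exact: (dirdiff_prod_jet c b).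
by rewrite partial_prod_jet; do 2 eexists; reflexivity.
Qed.

(** Each derivative in direction [j] raises [b j] and, by the normalization of the jets, contributes
    the factor [b j + 1]. So [c] is the product of the factorials of the [b i]; only its bound is
    recorded. *)
Lemma partials_prod_jet s : exists c b,
  [/\ partials s (prod_jet 1 (fun=> 0%N)) = prod_jet c b,
      (\sum_i b i = size s)%N, 0 <= c & c <= (size s)`!%:R].
Proof.
elim: s => [|j s [c [b [IH bs c0 cs]]]].
  by exists 1, (fun=> 0%N); rewrite big1.
exists (c * (b j).+1%:R), (fun i => b i + (i == j))%N; split.
- by rewrite /= IH partial_prod_jet.
- rewrite big_split/= bs (bigD1 j)//= eqxx big1 ?addn1// => i ij.
  by rewrite (negPf ij).
- by rewrite mulr_ge0.
- rewrite /= factS natrM mulrC; apply: ler_pM => //.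
  rewrite ler_nat ltnS -bs (bigD1 j)//=.
  exact: leq_addr.
Qed.

Lemma modulus_partials_prod_jet s x :
  modulus (partials s (prod_jet 1 (fun=> 0%N)) x) <=
    A ^+ size s * (size s)`!%:R * \prod_i U 0%N (x 0 i).
Proof.
have [c [b [-> <- c0 cs]]] := partials_prod_jet s.
rewrite /prod_jet modulus_real normrM (ger0_norm c0) normr_prod.
have A0 : 0 <= A.
  have := le_trans (normr_ge0 _) (tame_le tU 1 0).
  by rewrite expr1 pmulr_lge0// (tame_gt0 tU).
rewrite [leRHS]mulrAC mulrC; apply: ler_pM => //; first exact: prodr_ge0.
rewrite -prodrXr -big_split/=; apply: ler_prod => i _.
by rewrite normr_ge0 (tame_le tU).
Qed.

End ProductJets.

(** * Seminorms *)

Section Seminorms.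
Variables (R : realType) (N : nat) (omega : R -> R).
Hypotheses (N0 : (0 < N)%N) (homega : nonquasianalytic_weight omega).
Implicit Types (f g h : Efun R N) (a b : multiindex N) (x : 'rV[R]_N).

Lemma euclid_norm_ge0 x : 0 <= euclid_norm x.
Proof. exact: sqrtr_ge0. Qed.

Lemma euclid_norm_ge_coord x j : `|x 0 j| <= euclid_norm x.
Proof.
rewrite -sqrtr_sqr /euclid_norm ler_wsqrtr// (bigD1 j)//= lerDl.
by rewrite sumr_ge0// => i _; exact: sqr_ge0.
Qed.

Lemma euclid_norm_le_sum x : euclid_norm x <= \sum_j `|x 0 j|.
Proof.
have s0 : 0 <= \sum_j `|x 0 j| by rewrite sumr_ge0.
rewrite -[leRHS](ger0_norm s0) -sqrtr_sqr ler_wsqrtr//.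
rewrite expr2 mulr_suml; apply: ler_sum => j _.
rewrite -real_normK ?num_real// expr2 ler_wpM2l//.
by rewrite (bigD1 j)//= lerDl sumr_ge0.
Qed.

(** Some coordinate satisfies [|x| <= N |x_j|], as the norm is at most the sum of the [|x_j|]. The
    weight then splits over the coordinates, as a product of functions of one variable requires. *)
Lemma weight_euclid_norm_le : exists2 K : R, 0 <= K &
  forall x, omega (euclid_norm x) <= K * (1 + \sum_j omega `|x 0 j|).
Proof.
have [K K1 hK] := weight_dilate homega (ler0n R N).
exists K => [|x]; first by lra.
have w0 j : 0 <= omega `|x 0 j| by rewrite (weight_ge0 homega).
have [j hj] : exists j, euclid_norm x <= N%:R * `|x 0 j|.
  apply: contrapT => /forallNP hN.
  have : \sum_(j < N) N%:R * `|x 0 j| < \sum_(j < N) euclid_norm x.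
    apply: ltr_sum => [|j _]; last by rewrite ltNge; apply/negP/hN.
    by apply/hasP; exists (Ordinal N0) => //; rewrite mem_index_enum.
  rewrite -mulr_sumr sumr_const card_ord -[ltRHS]mulr_natl ltr_pM2l ?ltr0n//.
  by rewrite ltNge euclid_norm_le_sum.
apply: (le_trans (weight_mono homega (euclid_norm_ge0 x) hj)).
apply: (le_trans (hK _ (normr_ge0 _))).
rewrite ler_wpM2l ?lerD2l//; first by lra.
by rewrite (bigD1 j)//= lerDl sumr_ge0.
Qed.

Lemma qnorm_elemE l m a x f : 0 < l ->
  (expeR (- scaled_conj omega l a) *
    (expR (m * omega (euclid_norm x)) * modulus (mderiv a f x))%:E)%E =
  (conj_weight omega l (mlength a) *
    (expR (m * omega (euclid_norm x)) * modulus (mderiv a f x)))%:E.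
Proof. by move=> l0; rewrite expeR_scaled_conj// EFinM. Qed.

Lemma qnorm_le l m f (C : R) : 0 < l -> (forall a x,
    conj_weight omega l (mlength a) *
      (expR (m * omega (euclid_norm x)) * modulus (mderiv a f x)) <= C) ->
  (qnorm omega l m f <= C%:E)%E.
Proof.
move=> l0 h; apply: ge_ereal_sup => _ [[a x] _ <-].
by rewrite qnorm_elemE// lee_fin; exact: h.
Qed.

Lemma qnorm_ge l m f a x : 0 < l ->
  ((conj_weight omega l (mlength a) *
      (expR (m * omega (euclid_norm x)) * modulus (mderiv a f x)))%:E <=
   qnorm omega l m f)%E.
Proof.
move=> l0; apply: ereal_sup_ubound; exists (a, x) => //=.
exact: qnorm_elemE.
Qed.

Lemma qnorm_ge0 l m f : 0 < l -> (0 <= qnorm omega l m f)%E.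
Proof.
move=> l0; apply: le_trans (qnorm_ge m f (fun=> 0%N) 0 l0).
by rewrite lee_fin mulr_ge0 ?conj_weight_ge0// mulr_ge0 ?expR_ge0 ?modulus_ge0.
Qed.

Lemma qnormD l m f g : 0 < l -> smooth f -> smooth g ->
  (qnorm omega l m (f + g)%R <= qnorm omega l m f + qnorm omega l m g)%E.
Proof.
move=> l0 sf sg; apply: ge_ereal_sup => _ [[a x] _ <-].
rewrite qnorm_elemE// (mderivD a sf sg).
apply: le_trans (leeD (qnorm_ge m f a x l0) (qnorm_ge m g a x l0)).
rewrite -EFinD lee_fin -mulrDr ler_wpM2l ?conj_weight_ge0// -mulrDr.
by rewrite ler_wpM2l ?expR_ge0// modulus_add.
Qed.

Lemma qnormZ l m f (c : R[i]) (M : R) : 0 < l -> smooth f ->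
  (qnorm omega l m f <= M%:E)%E ->
  (qnorm omega l m (c *: f) <= (modulus c * M)%:E)%E.
Proof.
move=> l0 sf fM; apply: qnorm_le => // a x; rewrite (mderivZ a c sf).
have := le_trans (qnorm_ge m f a x l0) fM; rewrite lee_fin => h.
have -> : modulus ((c *: mderiv a f) x) = modulus c * modulus (mderiv a f x).
  exact: modulus_mul.
apply: le_trans (ler_wpM2l (modulus_ge0 c) h).
by rewrite le_eqVlt; apply/orP; left; apply/eqP; ring.
Qed.

Lemma qnorm0 l m : 0 < l -> (qnorm omega l m (0%R : Efun R N) <= 0)%E.
Proof.
move=> l0; apply: qnorm_le => // a x; rewrite mderiv0 modulus0.
by rewrite !mulr0.
Qed.

Lemma Sset0 : Sset omega (0 : Efun R N).
Proof.
split=> [|l m l0 m0]; first exact: (@smooth_cst R N 0).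
by apply: le_lt_trans (qnorm0 m l0) _; rewrite ltry.
Qed.

Lemma SsetZ (c : R[i]) f : Sset omega f -> Sset omega (c *: f).
Proof.
move=> [sf hf]; split=> [|l m l0 m0]; first exact: (smoothZ c sf).
have := hf l m l0 m0; have := qnorm_ge0 m f l0.
case E : (qnorm _ _ _ _) => [M| |]// _ _.
by apply: le_lt_trans (qnormZ c l0 sf _) (ltry _); rewrite E.
Qed.

Lemma lc_bounded_Sspace1 (g : Sspace N omega) :
  lc_bounded (@Sset R N omega) (@S_seminorms R N omega) [set g].
Proof.
have [sg hg] : Sset omega (\val g) by exact: set_valP.
apply: lc_bounded_set1 => [t|_ [m m0 [n n0 <-]]].
  by apply: SsetZ; exact: set_valP.
have m0' : 0 < m%:R :> R by rewrite ltr0n.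
have n0' : 0 < n%:R :> R by rewrite ltr0n.
have := hg _ _ m0' n0'; have := qnorm_ge0 n%:R (\val g) m0'.
case E : (qnorm _ _ _ _) => [M| |]// M0 _; exists M => // f t [sf _].
rewrite -[X in qnorm _ _ _ X](_ : t%:C%C *: \val g + (0 - f) = _); last first.
  by rewrite add0r.
apply: (le_trans (qnormD _ m0' (smoothZ _ sg) _)).
  exact: (smoothB (@smooth_cst R N 0) sf).
apply: leeD => //; rewrite -modulus_real; apply: (qnormZ _ m0' sg).
by rewrite E.
Qed.

Lemma lc_bounded_qnorm (B : set (Sspace N omega)) m n :
  lc_bounded (@Sset R N omega) (@S_seminorms R N omega) B -> (0 < m)%N -> (0 < n)%N ->
  exists D : R, forall g : Sspace N omega, B g ->
    (qnorm omega m%:R n%:R (\val g) <= D%:E)%E.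
Proof.
move=> hB m0 n0; have m0' : 0 < m%:R :> R by rewrite ltr0n.
pose z : Sspace N omega := exist _ 0 (mem_set Sset0).
have bz : @seminorm_ball _ _ _ (@Sset R N omega) (@S_seminorms R N omega)
    (qnorm omega m%:R n%:R) z 1 z.
  by rewrite /seminorm_ball /= subrr; apply: le_lt_trans (qnorm0 _ m0') _.
have [|r r0 hr] := hB z erefl _ (nbhs_seminorm_ball _ ltr01 bz).
  by exists m => //; exists n.
exists (modulus r) => g /hr[u]; rewrite /seminorm_ball /= subr0 => u1 ->.
have [su _] : Sset omega (\val u) by exact: set_valP.
by rewrite -[modulus r]mulr1; apply: (qnormZ _ m0' su); exact: ltW.
Qed.

End Seminorms.

(** * Majorants in several variables that belong to the Beurling-Bjorck space *)

Section Domination.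
Variables (R : realType) (N : nat) (omega : R -> R).
Hypotheses (N0 : (0 < N)%N) (homega : nonquasianalytic_weight omega).
Implicit Types (f g : Efun R N) (x : 'rV[R]_N).

(** The factor [A^k k!] from the derivatives is absorbed by [conj_weight_fact], and
    [exp (m omega |x|)] by the decay of the factors, one coordinate at a time. *)
Lemma Sset_prod_jet (A : R) (U : nat -> R -> R) : 0 < A -> tame A U ->
  (forall m : nat, exists C : R, forall t,
     expR (m%:R * omega `|t|) * U 0%N t <= C) ->
  Sset omega (@prod_jet R N U 1 (fun=> 0%N)).
Proof.
move=> A0 tU hU; split=> [|l m l0 m0]; first exact: (smooth_prod_jet tU).
have [K K0 hK] := weight_euclid_norm_le N0 homega.
have [C C0 hC] := conj_weight_fact homega l0 A0.
pose M := (Num.Def.truncn (m * K)).+1.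
have hM : m * K <= M%:R by apply/ltW/truncnS_gt.
have [D hD] := hU M.
have P0 x : 0 <= \prod_j U 0%N (x 0 j).
  by apply: prodr_ge0 => j _; rewrite ltW// (tame_gt0 tU).
apply: (@le_lt_trans _ _ (C * (expR (m * K) * D ^+ N))%:E); last exact: ltry.
apply: (qnorm_le homega l0) => a x; rewrite mderivE.
have hp := modulus_partials_prod_jet tU (multiindex_seq a) x.
rewrite size_multiindex_seq in hp.
have v0 := conj_weight_ge0 omega l (mlength a).
set e := expR _; have e0 : 0 <= e by exact: expR_ge0.
apply: (le_trans (ler_wpM2l v0 (ler_wpM2l e0 hp))).
have -> : conj_weight omega l (mlength a) *
    (e * (A ^+ mlength a * (mlength a)`!%:R * \prod_i U 0%N (x 0 i))) =
  A ^+ mlength a * (mlength a)`!%:R * conj_weight omega l (mlength a) *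
    (e * \prod_i U 0%N (x 0 i)) by ring.
apply: ler_pM; rewrite ?mulr_ge0 ?exprn_ge0 ?(ltW A0)//.
apply: (@le_trans _ _ (expR (m * K) *
    \prod_j (expR (M%:R * omega `|x 0 j|) * U 0%N (x 0 j)))); last first.
  rewrite ler_wpM2l ?expR_ge0//.
  rewrite -[N in D ^+ N]card_ord -prodr_const; apply: ler_prod => j _.
  by rewrite hD mulr_ge0 ?expR_ge0// ltW// (tame_gt0 tU).
rewrite big_split/= mulrA ler_wpM2r// -expR_sum -expRD ler_expR -mulr_sumr.
have s0 : 0 <= \sum_j omega `|x 0 j|.
  by apply: sumr_ge0 => j _; rewrite (weight_ge0 homega).
apply: (le_trans (ler_wpM2l (ltW m0) (hK x))).
by rewrite mulrA mulrDr mulr1 lerD2l ler_wpM2r.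
Qed.

(** Each of the [N] factors has to majorize the [N]-th root of [y], which is possible as
    [omega |x_j| <= omega |x|]. Extracting the root divides the rate of decay by [N], hence the
    index [k * N]; the maximum with 1 gives [E k <= E k ^ N]. *)
Lemma prod_majorant (D : nat -> R) : exists U : nat -> R -> R,
  [/\ tame 2 U, Sset omega (@prod_jet R N U 1 (fun=> 0%N)) &
   forall x y, (forall k : nat, y <= D k * expR (- (k%:R * omega (euclid_norm x)))) ->
     y <= \prod_i U 0%N (x 0 i)].
Proof.
pose E k := Num.max 1 (D (k * N)%N).
have E1 k : 1 <= E k by rewrite /E le_max lexx.
have [U [tU lowU upU]] := tame_majorant homega E1.
exists U; split=> //; first exact: (Sset_prod_jet _ tU upU).
move=> x y hy.
have U0 i : 0 < U 0%N (x 0 i) by exact: tame_gt0 tU _.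
have [y0|y0] := leP y 0.
  by apply: (le_trans y0); apply: prodr_ge0 => i _; exact: ltW.
pose z := expR (ln y / N%:R).
have Nn0 : N%:R != 0 :> R by rewrite pnatr_eq0 -lt0n.
have zN : z ^+ N = y by rewrite -expRM_natl mulrC divfK// lnK.
have zE k : z <= E k * expR (- (k%:R * omega (euclid_norm x))).
  have E0 : 0 < E k by exact: lt_le_trans (E1 k).
  rewrite -(ler_pXn2r N0) ?nnegrE ?expR_ge0 ?mulr_ge0 ?expR_ge0 ?(ltW E0)//.
  rewrite zN; apply: (le_trans (hy (k * N)%N)).
  have -> : expR (- ((k * N)%:R * omega (euclid_norm x))) =
      expR (- (k%:R * omega (euclid_norm x))) ^+ N.
    by rewrite -expRM_natl natrM; congr expR; ring.
  rewrite exprMn ler_wpM2r ?exprn_ge0 ?expR_ge0//.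
  apply: (@le_trans _ _ (E k)); first by rewrite /E le_max lexx orbT.
  by rewrite ler_eXnr.
rewrite -zN -[N in z ^+ N]card_ord -prodr_const; apply: ler_prod => i _.
rewrite expR_ge0/=; apply: lowU => k; apply: (le_trans (zE k)).
rewrite ler_wpM2l ?(le_trans ler01 (E1 k))// ler_expR lerN2 ler_wpM2l//.
exact: weight_mono (euclid_norm_ge_coord x i).
Qed.

End Domination.

(** * Comparison of the seminorms of the three topologies *)

Section Comparison.
Variables (R : realType) (N : nat) (omega : R -> R).
Hypotheses (N0 : (0 < N)%N) (homega : nonquasianalytic_weight omega).
Implicit Types (f : Efun R N) (g : Sspace N omega) (x : 'rV[R]_N).
Implicit Types (a b : multiindex N).

Lemma tau_elemE m g f a x : (0 < m)%N ->
  ((modulus (\val g x) * modulus (mderiv a f x))%:E *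
    expeR (- scaled_conj omega m%:R a))%E =
  (modulus (\val g x) * modulus (mderiv a f x) *
    conj_weight omega m%:R (mlength a))%:E.
Proof. by move=> m0; rewrite expeR_scaled_conj ?ltr0n// EFinM. Qed.

Lemma tau_seminorm_ge m g f a x : (0 < m)%N ->
  ((modulus (\val g x) * modulus (mderiv a f x) *
    conj_weight omega m%:R (mlength a))%:E <= tau_seminorm m g f)%E.
Proof.
move=> m0; apply: ereal_sup_ubound; exists (a, x) => //=.
exact: tau_elemE.
Qed.

Lemma tau_seminorm_ge0 m g f : (0 < m)%N -> (0 <= tau_seminorm m g f)%E.
Proof.
move=> m0; apply: le_trans (tau_seminorm_ge g f (fun=> 0%N) 0 m0).
by rewrite lee_fin mulr_ge0 ?conj_weight_ge0// mulr_ge0 ?modulus_ge0.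
Qed.

Lemma tau_seminorm_le m g f (C : R) : (0 < m)%N -> (forall a x,
    modulus (\val g x) * modulus (mderiv a f x) *
      conj_weight omega m%:R (mlength a) <= C) ->
  (tau_seminorm m g f <= C%:E)%E.
Proof.
move=> m0 h; apply: ge_ereal_sup => _ [[a x] _ <-].
by rewrite tau_elemE// lee_fin; exact: h.
Qed.

Lemma tau_seminormD m g f1 f2 : (0 < m)%N -> smooth f1 -> smooth f2 ->
  (tau_seminorm m g (f1 + f2)%R <= tau_seminorm m g f1 + tau_seminorm m g f2)%E.
Proof.
move=> m0 s1 s2; apply: ge_ereal_sup => _ [[a x] _ <-].
rewrite tau_elemE// (mderivD a s1 s2).
apply: le_trans (leeD (tau_seminorm_ge g f1 a x m0) (tau_seminorm_ge g f2 a x m0)).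
rewrite -EFinD lee_fin -mulrDl ler_wpM2r ?conj_weight_ge0// -mulrDr.
by rewrite ler_wpM2l ?modulus_ge0// modulus_add.
Qed.

Lemma tau_seminorm0 m g : (0 < m)%N -> (tau_seminorm m g (0%R : Efun R N) <= 0)%E.
Proof.
move=> m0; apply: tau_seminorm_le => // a x; rewrite mderiv0 modulus0.
by rewrite mulr0 mul0r.
Qed.

Lemma Sspace_smooth g : smooth (\val g).
Proof. by have [] : Sset omega (\val g) by exact: set_valP. Qed.

Lemma mulED f1 f2 (h : Efun R N) : mulE (f1 + f2) h = mulE f1 h + mulE f2 h.
Proof. by apply/funext => x; rewrite /mulE !fctE mulrDl. Qed.

Lemma taus_seminormD m n g f1 f2 : (0 < m)%N -> smooth f1 -> smooth f2 ->
  (taus_seminorm m n g (f1 + f2)%R <=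
   taus_seminorm m n g f1 + taus_seminorm m n g f2)%E.
Proof.
move=> m0 s1 s2; rewrite /taus_seminorm mulED; apply: (qnormD homega).
- by rewrite ltr0n.
- exact: (smoothM s1 (Sspace_smooth g)).
- exact: (smoothM s2 (Sspace_smooth g)).
Qed.

Lemma taus_seminorm0 m n g : (0 < m)%N ->
  (taus_seminorm m n g (0%R : Efun R N) <= 0)%E.
Proof.
move=> m0; rewrite /taus_seminorm.
have -> : mulE 0 (\val g) = 0 by apply/funext => x; rewrite /mulE mul0r.
by apply: (qnorm0 _ homega); rewrite ltr0n.
Qed.

Lemma taub_seminormD m n (B : set (Sspace N omega)) f1 f2 : (0 < m)%N ->
  smooth f1 -> smooth f2 ->
  (taub_seminorm m n B (f1 + f2)%R <=
   taub_seminorm m n B f1 + taub_seminorm m n B f2)%E.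
Proof.
move=> m0 s1 s2; apply: ge_ereal_sup => _ [g Bg <-].
apply: (le_trans (taus_seminormD n g m0 s1 s2)).
by apply: leeD; apply: ereal_sup_ubound; exists g.
Qed.

Lemma taub_seminorm1 m n g f : taub_seminorm m n [set g] f = taus_seminorm m n g f.
Proof. by rewrite /taub_seminorm image_set1 ereal_sup1. Qed.

Lemma taub_le_tau m n (B : set (Sspace N omega)) : (0 < m)%N -> (0 < n)%N ->
  lc_bounded (@Sset R N omega) (@S_seminorms R N omega) B ->
  exists (m' : nat) (h : Sspace N omega) (C : R),
    [/\ (0 < m')%N, 0 < C & forall f, smooth f ->
    (taub_seminorm m n B f <= C%:E * tau_seminorm m' h f)%E].
Proof.
move=> m0 n0 hB; have m0' : 0 < m%:R :> R by rewrite ltr0n.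
have [m' [C [m'0 C0 hC]]] := conj_weight_mul homega m0' (ler1n R 2 : 1 <= 2).
have m'0' : 0 < m'%:R :> R by rewrite ltr0n.
(* In the index [k + n], the part [n] supplies the factor [exp (n omega)] of the seminorm to be
   bounded, and the arbitrary [k] the rapid decay needed for a majorant. The bounds are uniform over
   [B] and over all orders of derivation. *)
have /choice[D hD] : forall k, exists D : R, forall g : Sspace N omega, B g ->
    (qnorm omega m'%:R (k + n)%:R (\val g) <= D%:E)%E.
  by move=> k; apply: (lc_bounded_qnorm homega hB m'0); rewrite addn_gt0 n0 orbT.
have [U [tU hS hU]] := prod_majorant N0 homega D.
pose h : Sspace N omega :=
  exist _ (@prod_jet R N U 1 (fun=> 0%N)) (mem_set hS).
exists m', h, C; split=> // f sf.
have := tau_seminorm_ge0 h f m'0.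
case E : (tau_seminorm m' h f) => [Q| |]// _; last first.
  by rewrite gt0_muley ?lte_fin// leey.
apply: ge_ereal_sup => _ [g Bg <-]; rewrite -EFinM.
apply: (qnorm_le homega m0') => a x; rewrite mulrA.
set e := expR _; have e0 : 0 <= e by exact: expR_ge0.
have v0 k l := @conj_weight_ge0 R omega k l.
apply: (mderiv_leibniz_le sf (Sspace_smooth g)) => [|b b' bb'].
  by rewrite mulr_ge0.
have hC' := hC (mlength b) (mlength b'); rewrite bb' in hC'.
set F := modulus (mderiv b f x); set G := modulus (mderiv b' (\val g) x).
have F0 : 0 <= F by exact: modulus_ge0.
have G0 : 0 <= G by exact: modulus_ge0.
have hG : conj_weight omega m'%:R (mlength b') * (e * G) <= modulus (\val h x).
  have -> : \val h x = (\prod_i U 0%N (x 0 i))%:C%C.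
    by rewrite -[\prod_i _]mul1r.
  rewrite modulus_real ger0_norm; last first.
    by apply: prodr_ge0 => j _; rewrite ltW// (tame_gt0 tU).
  apply: hU => k; rewrite expRN ler_pdivlMr ?expR_gt0//.
  have := le_trans (qnorm_ge homega (k + n)%:R (\val g) b' x m'0') (hD k g Bg).
  by rewrite lee_fin natrD mulrDl expRD -/e -/G; lra.
have hF : modulus (\val h x) * F * conj_weight omega m'%:R (mlength b) <= Q.
  by rewrite -lee_fin -E; exact: tau_seminorm_ge.
have -> : 2 ^+ mlength a * (conj_weight omega m%:R (mlength a) * e) * (F * G) =
  2 ^+ mlength a * conj_weight omega m%:R (mlength a) * (F * (e * G)) by ring.
have FG0 : 0 <= F * (e * G) by rewrite !mulr_ge0.
apply: (le_trans (ler_wpM2r FG0 hC')).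
rewrite -mulrA ler_pM2l//; apply: le_trans hF.
have vF0 : 0 <= conj_weight omega m'%:R (mlength b) * F by rewrite mulr_ge0.
by have := ler_wpM2l vF0 hG; lra.
Qed.

Lemma Sspace_decay g (k : nat) : exists D : R,
  forall x, modulus (\val g x) <= D * expR (- (k%:R * omega (euclid_norm x))).
Proof.
have [_ hg] : Sset omega (\val g) by exact: set_valP.
have h1 : 0 < 1 :> R by [].
have hk : 0 < k.+1%:R :> R by rewrite ltr0n.
have := hg _ _ h1 hk; have := qnorm_ge0 homega k.+1%:R (\val g) h1.
case E : (qnorm _ _ _ _) => [D| |]// D0 _; exists D => x.
pose o : multiindex N := fun=> 0%N.
have o0 : mlength o = 0%N by rewrite /mlength big1.
have := qnorm_ge homega k.+1%:R (\val g) o x h1; rewrite E lee_fin.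
have -> : mderiv o (\val g) x = \val g x.
  rewrite mderivE; suff -> : multiindex_seq o = [::] by [].
  by apply: size0nil; rewrite size_multiindex_seq.
have v1 : 1 <= conj_weight omega 1 (mlength o).
  apply: (conj_weight_ge homega h1) => r r1; rewrite o0 expr0 mulr1 mul1r.
  by rewrite -expR0 ler_expR (weight_ge0 homega)//; lra.
move=> h; rewrite expRN ler_pdivlMr ?expR_gt0//; apply: le_trans h.
have w0 := weight_ge0 homega (euclid_norm_ge0 x).
have ee : expR (k%:R * omega (euclid_norm x)) <=
    expR (k.+1%:R * omega (euclid_norm x)).
  by rewrite ler_expR ler_wpM2r// ler_nat.
rewrite -[leLHS]mul1r; apply: ler_pM => //.
  by rewrite mulr_ge0 ?modulus_ge0 ?expR_ge0.
by rewrite mulrC ler_wpM2r ?modulus_ge0.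
Qed.

(* In [f = (f h) (1 / h)], with [h] a product of functions [U 0] such that
   [tame 2 U], the derivatives of [1 / h] are at most [4 ^ k k! / h]. *)
Lemma tau_le_taus m g : (0 < m)%N ->
  exists (m' : nat) (h : Sspace N omega) (C : R),
    [/\ (0 < m')%N, 0 < C & forall f, smooth f ->
    (tau_seminorm m g f <= C%:E * taus_seminorm m' 1 h f)%E].
Proof.
move=> m0; have m0' : 0 < m%:R :> R by rewrite ltr0n.
have [m' [C [m'0 C0 hC]]] := conj_weight_mul homega m0' (ler1n R 2 : 1 <= 2).
have m'0' : 0 < m'%:R :> R by rewrite ltr0n.
have /choice[D hD] := Sspace_decay g.
have [U [tU hS hU]] := prod_majorant N0 homega D.
pose h : Sspace N omega :=
  exist _ (@prod_jet R N U 1 (fun=> 0%N)) (mem_set hS).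
(* The constant of [1 / h]: 2 for the factors of [h], doubled by [tame_inv]. *)
have h4 : 0 < 2 * 2 :> R by [].
have [C1 C10 hC1] := conj_weight_fact homega m'0' h4.
have tV := tame_inv tU.
pose k : Efun R N := prod_jet (inv_jet U) 1 (fun=> 0%N).
exists m', h, (C * C1); split=> [//||f sf]; first by rewrite mulr_gt0.
have sF := smoothM sf (Sspace_smooth h).
have sk : smooth k by exact: (smooth_prod_jet tV).
have fhk : mulE (mulE f (\val h)) k = f.
  apply/funext => x; rewrite /mulE.
  have -> : \val h x = (\prod_i U 0%N (x 0 i))%:C%C.
    by rewrite -[\prod_i _]mul1r.
  have -> : k x = (\prod_i inv_jet U 0 (x 0 i))%:C%C.
    by rewrite -[\prod_i _]mul1r.
  rewrite -mulrA -rmorphM -big_split/= big1 ?rmorph1 ?mulr1// => i _.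
  by rewrite inv_jet0 divff// gt_eqF// (tame_gt0 tU).
have := qnorm_ge0 homega 1%:R (mulE f (\val h)) m'0'.
rewrite -/(taus_seminorm m' 1 h f).
case E : (taus_seminorm m' 1 h f) => [Q| |]// Q0; last first.
  by rewrite gt0_muley ?lte_fin ?mulr_gt0// leey.
apply: tau_seminorm_le => // a x; rewrite -fhk mulrAC.
have v0 i l := @conj_weight_ge0 R omega i l.
apply: (mderiv_leibniz_le sF sk) => [|b b' bb'].
  by rewrite mulr_ge0 ?modulus_ge0.
have hC' := hC (mlength b) (mlength b'); rewrite bb' in hC'.
set F := modulus (mderiv b (mulE f (\val h)) x); set G := modulus (mderiv b' k x).
have F0 : 0 <= F by exact: modulus_ge0.
have G0 : 0 <= G by exact: modulus_ge0.
have w0 := weight_ge0 homega (euclid_norm_ge0 x).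
have hF : conj_weight omega m'%:R (mlength b) * F <= Q.
  have := qnorm_ge homega 1%:R (mulE f (\val h)) b x m'0'.
  rewrite -/(taus_seminorm m' 1 h f) E lee_fin; apply: le_trans.
  rewrite ler_wpM2l// ler_peMl// -expR0 ler_expR mulr_ge0//.
have hG : G <= (2 * 2) ^+ mlength b' * (mlength b')`!%:R *
    \prod_i inv_jet U 0 (x 0 i).
  rewrite /G mderivE -size_multiindex_seq.
  exact: modulus_partials_prod_jet tV _ _.
have V0 : 0 <= \prod_i inv_jet U 0 (x 0 i).
  by apply: prodr_ge0 => i _; rewrite ltW// (tame_gt0 tV).
(* The choice of [h] as a majorant of [g] enters here: [|g| / h <= 1] cancels the size of [1 / h] in
   the bound [hG] on its derivatives. *)
have gV : modulus (\val g x) * \prod_i inv_jet U 0 (x 0 i) <= 1.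
  apply: (le_trans (ler_wpM2r V0 (hU x _ (fun i => hD i x)))).
  rewrite -big_split/= big1// => i _.
  by rewrite inv_jet0 divff// gt_eqF// (tame_gt0 tU).
have gG : conj_weight omega m'%:R (mlength b') * (modulus (\val g x) * G) <= C1.
  have g0 := modulus_ge0 (\val g x : R[i]).
  apply: (le_trans (ler_wpM2l (v0 _ _) (ler_wpM2l g0 hG))).
  apply: le_trans (hC1 (mlength b')).
  set A := (2 * 2) ^+ _ * _; set V := \prod_i _ in V0 gV *.
  set v := conj_weight _ _ _.
  have Av : 0 <= A * v by rewrite !mulr_ge0 ?exprn_ge0 ?v0.
  by have := ler_wpM2l Av gV; lra.
set v := conj_weight omega m%:R _ in hC' *; set g' := modulus (\val g x) in gG *.
have -> : 2 ^+ mlength a * (g' * v) * (F * G) =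
  2 ^+ mlength a * v * (F * (g' * G)) by ring.
have FG0 : 0 <= F * (g' * G) by rewrite !mulr_ge0 ?modulus_ge0.
apply: (le_trans (ler_wpM2r FG0 hC')).
rewrite -!mulrA ler_pM2l//.
set v1 := conj_weight _ _ _ in hF *; set v2 := conj_weight _ _ _ in gG *.
have -> : v1 * (v2 * (F * (g' * G))) = v2 * (g' * G) * (v1 * F) by ring.
by apply: ler_pM => //; rewrite !mulr_ge0 ?v0 ?modulus_ge0.
Qed.

End Comparison.


Theorem theorem5p9 (R : realType) (N : nat) (hN : (0 < N)%N) (omega : R -> R)
    (homega : nonquasianalytic_weight omega) :
  [/\ continuous (fun f : OM_tau N omega => f : OM_taub N omega),
      continuous (fun f : OM_taub N omega => f : OM_taus N omega) &
      forall B : set (OM N omega),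
        (lc_bounded (OM N omega) (tau_seminorms N omega) B <->
         lc_bounded (OM N omega) (taub_seminorms N omega) B) /\
        (lc_bounded (OM N omega) (taub_seminorms N omega) B <->
         lc_bounded (OM N omega) (taus_seminorms N omega) B)].
Proof.
have sB (f g : Efun R N) : OM N omega f -> OM N omega g -> smooth (f - g).
  by move=> [sf _] [sg _]; exact: (smoothB sf sg).
have tri (f g h : Efun R N) : f - h = (f - g) + (g - h).
  by rewrite addrA subrK.
have c1 : continuous (fun f : OM_tau N omega => f : OM_taub N omega).
  apply: lcspace_id_continuous => _ [m [n [B [m0 n0 hB ->]]]]; split.
    move=> f g h Xf Xg Xh; rewrite (tri f g h).
    exact: (taub_seminormD homega n B m0 (sB _ _ Xf Xg) (sB _ _ Xg Xh)).
  have [m' [h [C [m'0 C0 hC]]]] := taub_le_tau hN homega m0 n0 hB.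
  exists (tau_seminorm m' h), C; split => //.
  - by exists m' => //; exists h.
  - exact: (tau_seminorm0 homega h m'0).
  - by move=> f g Xf Xg; exact: (hC _ (sB _ _ Xf Xg)).
have c2 : continuous (fun f : OM_taub N omega => f : OM_taus N omega).
  apply: lcspace_id_continuous => _ [m [n [g [m0 n0 ->]]]]; split.
    move=> f1 f2 h Xf Xg Xh; rewrite (tri f1 f2 h).
    exact: (taus_seminormD homega n g m0 (sB _ _ Xf Xg) (sB _ _ Xg Xh)).
  exists (taub_seminorm m n [set g]), 1; split.
  - by exists m, n, [set g]; split=> //; exact: (lc_bounded_Sspace1 homega g).
  - exact: ltr01.
  - by rewrite taub_seminorm1; exact: (taus_seminorm0 homega n g m0).
  - by move=> f1 f2 _ _; rewrite taub_seminorm1 mul1e.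
(* The third comparison closes the cycle tau, tau_b, tau_s, tau; continuous identity maps preserve
   boundedness, so each missing implication is obtained by going round the cycle. *)
have c3 : continuous (fun f : OM_taus N omega => f : OM_tau N omega).
  apply: lcspace_id_continuous => _ [m m0 [g _ <-]]; split.
    move=> f1 f2 h Xf Xg Xh; rewrite (tri f1 f2 h).
    exact: (tau_seminormD homega g m0 (sB _ _ Xf Xg) (sB _ _ Xg Xh)).
  have [m' [h [C [m'0 C0 hC]]]] := tau_le_taus hN homega g m0.
  exists (taus_seminorm m' 1 h), C; split => //.
  - by exists m', 1%N, h.
  - exact: (taus_seminorm0 homega 1 h m'0).
  - by move=> f1 f2 Xf Xg; exact: (hC _ (sB _ _ Xf Xg)).
have b1 := fun B : set (OM N omega) => lc_bounded_continuous (B := B) c1.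
have b2 := fun B : set (OM N omega) => lc_bounded_continuous (B := B) c2.
have b3 := fun B : set (OM N omega) => lc_bounded_continuous (B := B) c3.
split=> // B; split; split; [exact: b1| |exact: b2|].
- by move=> /b2 /b3.
- by move=> /b3 /b1.
Qed.
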